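(* Let $G=(V,w,m)$ be a finite connected weighted graph, let $K>0$ and let $D:=\operatorname{Deg}_{\max}$. Let $0=\lambda_0<\lambda_1\le\lambda_2\le\dots$ be the eigenvalues of $-\Delta$ counted with multiplicity. The following are equivalent: (1) $G$ is a $\frac{2D}{K}$-dimensional hypercube with constant edge degree $\frac K2$. (2) $G$ satisfies $CD(K,\infty)$ and $\lambda_{\deg_{\max}}=K$. (3) $G$ has constant edge degree $\kappa_0$ for some $\kappa_0>0$, satisfies $CD(K,\infty)$, and $\operatorname{diam}_d(G)=\frac{2D}{K}$. (4) $G$ has constant edge degree $\kappa_0$ for some $\kappa_0>0$, has the hypercube shell structure $HSS\left(\frac{2D}{K},\frac K2\right)$, and satisfies $CD(K,\infty)$. (5) $G$ has constant edge degree $\frac K2$, and its unweighted representation $\widetilde G$ has the hypercube shell structure $HSS\left(\frac{2D}{K},1\right)$ and satisfies the small sphere property (SSP) and the non-clustering property (NCP) at every vertex.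
   Context: A weighted graph is a triple $G=(V,w,m)$ with $V$ a countable set, $w:V\times V\to[0,\infty)$ symmetric with $w(x,x)=0$, and $m:V\to(0,\infty)$; write $x\sim y$ iff $w(x,y)>0$; graphs are locally finite. The Laplacian is $\Delta f(x)=\frac1{m(x)}\sum_y w(x,y)(f(y)-f(x))$. Set $\operatorname{Deg}(x)=\frac1{m(x)}\sum_y w(x,y)$, $\operatorname{Deg}_{\max}=\sup_x\operatorname{Deg}(x)$, $\deg(x)=\#\{y:y\sim x\}$, $\deg_{\max}=\max_x\deg(x)$. $d(x,y)$ is the combinatorial distance (least number of steps $x=x_0\sim x_1\sim\dots\sim x_n=y$), $\operatorname{diam}_d(G)=\sup_{x,y}d(x,y)$, $S_k(x)=\{y:d(x,y)=k\}$, $B_k(x)=\{y:d(x,y)\le k\}$. Eigenvalues of $-\Delta$ are taken on $\ell^2(V,m)$ (where $-\Delta$ is self-adjoint). Bakry–Émery operators: $2\Gamma(f,g)=\Delta(fg)-f\Delta g-g\Delta f$, $2\Gamma_2(f,g)=\Delta\Gamma(f,g)-\Gamma(f,\Delta g)-\Gamma(g,\Delta f)$, $\Gamma f=\Gamma(f,f)$, $\Gamma_2f=\Gamma_2(f,f)$. $G$ satisfies $CD(K,n)$ ($K\in\mathbb R$, $n\in(0,\infty]$) at $x$ if $\Gamma_2 f(x)\ge\frac1n(\Delta f(x))^2+K\Gamma f(x)$ for all $f:V\to\mathbb R$, and satisfies $CD(K,n)$ if this holds at all vertices. Constant edge degree $\kappa_0$: $w(x,y)/m(x)\in\{0,\kappa_0\}$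 for all $x,y\in V$. An unweighted graph $(V,E)$ is identified with the weighted graph with $w(x,y)=1$ if $\{x,y\}\in E$, $0$ otherwise, and $m\equiv1$. The unweighted representation $\widetilde G$ of $G=(V,w,m)$ is the unweighted graph with vertex set $V$ and edge set $\{\{x,y\}:w(x,y)>0\}$. Hypercube: for $N\in\mathbb N$, $H_N$ is the unweighted graph with vertex set the power set of $\{1,\dots,N\}$, with $A\sim B$ iff the symmetric difference $(A\cup B)\setminus(A\cap B)$ has exactly one element. A weighted graph is an $N$-dimensional hypercube if its unweighted representation is isomorphic to $H_N$. Backward/forward degrees: $d_-^{x_0}(z)=\sum_{y\sim z,\ d(y,x_0)<d(z,x_0)}\frac{w(y,z)}{m(z)}$, $d_+^{x_0}(z)=\sum_{y\sim z,\ d(y,x_0)>d(z,x_0)}\frac{w(y,z)}{m(z)}$. Hypercube shell structure $HSS(N,W,x_0)$ ($N,W>0$, $x_0\in V$): (i) $\operatorname{Deg}(x)=NW$ for all $x$; (ii) $G$ is bipartite; (iii) $d_-^{x_0}(x)=W\,d(x,x_0)$ for all $x\in V$. $G$ has $HSS(N,W)$ if it has $HSS(N,W,x_0)$ for some $x_0\in V$. For an unweighted $D'$-regular graph and a vertex $x$: (SSP) holds at $x$ if $\#S_2(x)\le\binom{D'}{2}$; (NCP) holds at $x$ if, whenever $d_-^x(z)=2$ for all $z\in S_2(x)$, for every $y_1,y_2\in S_1(x)$ there is at most one $z\in S_2(x)$ with $y_1\sim z\sim y_2$.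
   Formalization: The graph is assumed to have at least two vertices (for one vertex (1) and (3) hold but (2) fails), and (NCP) is required only for distinct y_1, y_2 in S_1(x) (with y_1 = y_2 allowed it already fails in the cube H_3). *)

(* Defs.v *)
(* Real scalars: an arbitrary real closed field R
   (the statement is first-order for each graph size, so this is the
   real case by Tarski transfer). *)
From HB Require Import structures.
From mathcomp Require Import all_boot all_order all_algebra.
Set Implicit Arguments. Unset Strict Implicit. Unset Printing Implicit Defensive.
Import Order.TTheory GRing.Theory Num.Theory.
Local Open Scope ring_scope.

Section WeightedGraph.
Variables (R : realFieldType) (V : finType) (w : V -> V -> R) (m : V -> R).

Definition weighted_graph : Prop :=
  [/\ forall x y, 0 <= w x y, forall x y, w x y = w y x,
      forall x, w x x = 0 & forall x, 0 < m x].

Definition adj : rel V := fun x y => 0 < w x y.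

Definition connected : Prop := forall x y, connect adj x y.

Fixpoint walkn (n : nat) (x y : V) : bool :=
  if n is n'.+1 then [exists z, adj x z && walkn n' z y] else x == y.

(* combinatorial distance: least n with a walk of n steps; in a connected
   finite graph this is < #|V|, so searching 0..#|V|-1 suffices
   (value #|V| only for disconnected pairs, which do not occur here). *)
Definition dist (x y : V) : nat := find (fun n => walkn n x y) (iota 0 #|V|).

Definition diam : nat := \max_(x : V) \max_(y : V) dist x y.

Definition sphere (k : nat) (x : V) : {set V} := [set y | dist x y == k].

Definition Lap (f : V -> R) (x : V) : R :=
  (m x)^-1 * \sum_(y : V) w x y * (f y - f x).

Definition Gam (f g : V -> R) (x : V) : R :=
  (Lap (fun z => f z * g z) x - f x * Lap g x - g x * Lap f x) / 2%:R.

Definition Gam2 (f g : V -> R) (x : V) : R :=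
  (Lap (fun z => Gam f g z) x - Gam f (Lap g) x - Gam g (Lap f) x) / 2%:R.

(* CD(K, oo): Gamma_2 f >= (1/oo) (Lap f)^2 + K Gamma f, with 1/oo = 0 *)
Definition CDinf (K : R) : Prop :=
  forall (f : V -> R) (x : V), K * Gam f f x <= Gam2 f f x.

Definition Deg (x : V) : R := (m x)^-1 * \sum_(y : V) w x y.
Definition Degmax : R := \big[Num.max/0]_(x : V) Deg x.

Definition deg (x : V) : nat := #|[set y | adj x y]|.
Definition degmax : nat := \max_(x : V) deg x.

Definition const_edge_deg (k0 : R) : Prop :=
  forall x y, w x y / m x = 0 \/ w x y / m x = k0.

Definition hcube_adj (N : nat) (A B : {set 'I_N}) : bool :=
  #|(A :|: B) :\: (A :&: B)| == 1%N.

Definition is_hypercube (N : nat) : Prop :=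
  exists f : V -> {set 'I_N},
    bijective f /\ forall x y, adj x y = hcube_adj (f x) (f y).

Definition dminus (x0 z : V) : R :=
  \sum_(y : V | adj y z && (dist y x0 < dist z x0)%N) w y z / m z.

Definition bipartite : Prop :=
  exists c : V -> bool, forall x y, adj x y -> c x != c y.

Definition HSS_at (N W : R) (x0 : V) : Prop :=
  [/\ 0 < N, 0 < W, forall x, Deg x = N * W, bipartite
    & forall x, dminus x0 x = W * (dist x x0)%:R].

Definition HSS (N W : R) : Prop := exists x0, HSS_at N W x0.

(* small sphere property, for an unweighted regular graph (D' = deg x) *)
Definition SSP (x : V) : Prop := (#|sphere 2 x| <= 'C(deg x, 2))%N.

Definition NCP (x : V) : Prop :=
  (forall z, z \in sphere 2 x -> dminus x z = 2%:R) ->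
  forall y1 y2, y1 \in sphere 1 x -> y2 \in sphere 1 x -> y1 != y2 ->
    (#|[set z in sphere 2 x | adj y1 z && adj z y2]| <= 1)%N.

Definition negLap_mx : 'M[R]_#|V| :=
  \matrix_(i, j) ((if i == j then Deg (enum_val i) else 0)
                  - w (enum_val i) (enum_val j) / m (enum_val i)).

Definition eigen_seq (s : seq R) : Prop :=
  sorted <=%R s /\ char_poly negLap_mx = \prod_(a <- s) ('X - a%:P).

Definition lambda_eq (k : nat) (c : R) : Prop :=
  exists s, eigen_seq s /\ nth 0 s k = c.

End WeightedGraph.

Definition unw (R : realFieldType) (V : finType) (w : V -> V -> R) : V -> V -> R :=
  fun x y => if 0 < w x y then 1 else 0.
Definition one_m (R : realFieldType) (V : finType) : V -> R := fun _ => 1.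

(* Main.v *)
Require Import Defs.
From HB Require Import structures.
From mathcomp Require Import all_boot all_order all_algebra.
From mathcomp Require Import zify ring lra.
Import Order.TTheory GRing.Theory Num.Theory.
Local Open Scope ring_scope.
Set Implicit Arguments. Unset Strict Implicit. Unset Printing Implicit Defensive.

(* Let D be the maximal degree. An eigenfunction f of -Delta for the eigenvalue K
   satisfies Gamma_2 f - K Gamma f = (Delta Gamma f)/2, which CD(K,oo) makes nonnegative,
   so Gamma f is subharmonic, hence constant, and f lies in the kernel of the
   positive semidefinite form Gamma_2 - K Gamma. Testing this against the
   indicator of z with d(x,z) = 2 shows that f(z) is determined by the values of
   f at x and at the common neighbours of x and z. Hence, if f grows by 1 along
   every edge at x0 and x0 has degree D, then f = f(x0) + d(x0,.), and the
   hypercube shell structure at x0 can be read off from Gamma f = D/2 and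
   Delta f = -K f.

   (2) => (4): nonzero eigenvalues are at least K and 0 is simple, so, Delta being
   self-adjoint, the K-eigenspace has dimension at least deg_max; since
   Gamma is constant on it, taking gradients at a vertex is injective,
   hence bijective, and eigenfunctions with prescribed gradients exist.

   (3) => (4): no heat semigroup is used. By CD(K,oo) the resolvent
   (1/2 (1 - Delta/K))^-1 and the Poisson operator K (-Delta)^-1 do not increase
   sup Gamma. The latter yields d(x,y) <= 2D/K, and equality at (x0,y0) makes the
   set of functions u with Gamma u <= D/2 and u(y0) - u(x0) = 2D/K, which contains
   d(x0,.) and whose members grow by 1 along each edge at x0, stable under the
   resolvent. Since Delta is semisimple, some combination with coefficient sum 1
   of the images of d(x0,.) under powers of the resolvent is a K-eigenfunction.

   (4) => (5): evaluate CD(K,oo) at functions supported on S_1(x) and S_2(x).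

   (5) => (1): writing c(x,z) for the number of common neighbours, SSP bounds
   sum_z (c(x,z) - 2) from below over S_2(x), while counting pairs of lower
   neighbours bounds sum c(x,z)(c(x,z) - 1) from above; so c = 2 for all pairs at
   distance 2, shell by shell. With NCP, any two neighbours of x have exactly one
   further common neighbour, and a vertex is determined by the set of neighbours
   of x0 lying on a geodesic from x0 to it. *)

(** * Combinatorial distance and the operators Delta and Gamma *)

Section Distance.
Variables (R : realFieldType) (V : finType) (w : V -> V -> R).
Hypothesis wC : forall x y, w x y = w y x.
Hypothesis w0 : forall x, w x x = 0.
Hypothesis conn : connected w.

Lemma adjC x y : adj w x y = adj w y x.
Proof. by rewrite /adj wC. Qed.

Lemma adjxx x : adj w x x = false.
Proof. by rewrite /adj w0 ltxx. Qed.

Lemma walkn_path n x y :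
  walkn w n x y <-> exists2 s, size s = n & path (adj w) x s /\ last x s = y.
Proof.
elim: n x => [|n IHn] x /=; first split.
- by move/eqP->; exists [::].
- by case=> s /size0nil-> [_ /= ->].
split.
- case/existsP=> z /andP[xz /IHn[s <- [ps <-]]].
  by exists (z :: s) => //=; rewrite xz ps.
case=> -[//|z s] /= [sn] [/andP[xz ps] ls].
by apply/existsP; exists z; rewrite xz; apply/IHn; exists s.
Qed.

Lemma walkn_lt x y : exists2 n, (n < #|V|)%N & walkn w n x y.
Proof.
have /connectP[s ps ->] := conn x y.
case: (shortenP ps) => s' ps' us' _.
exists (size s'); last by apply/walkn_path; exists s'.
by move/card_uniqP: us' => /= <-; apply: max_card.
Qed.

Lemma has_walkn x y : has (fun n => walkn w n x y) (iota 0 #|V|).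
Proof.
by have [n nV xy] := walkn_lt x y; apply/hasP; exists n; rewrite ?mem_iota.
Qed.

Lemma dist_walkn x y : walkn w (dist w x y) x y.
Proof.
have := nth_find 0%N (has_walkn x y); rewrite nth_iota //.
by have := has_walkn x y; rewrite has_find size_iota.
Qed.

Lemma dist_le n x y : walkn w n x y -> (dist w x y <= n)%N.
Proof.
move=> xy; rewrite leqNgt; apply/negP => lt_n.
have lt_V : (dist w x y < #|V|)%N.
  by have := has_walkn x y; rewrite has_find size_iota.
have := before_find 0%N lt_n; rewrite nth_iota ?(ltn_trans lt_n) //.
by rewrite add0n xy.
Qed.

Lemma walkn_cat n1 n2 x y z :
  walkn w n1 x y -> walkn w n2 y z -> walkn w (n1 + n2) x z.
Proof.
move=> /walkn_path[s1 <- [p1 l1]] /walkn_path[s2 <- [p2 l2]].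
apply/walkn_path; exists (s1 ++ s2); first by rewrite size_cat.
by rewrite cat_path last_cat p1 l1 p2.
Qed.

Lemma walkn1 x y : walkn w 1 x y = adj w x y.
Proof.
apply/existsP/idP => [[z /andP[xz /eqP<-]] //|xy].
by exists y; rewrite xy /= eqxx.
Qed.

Lemma walkn_sym n x y : walkn w n x y -> walkn w n y x.
Proof.
elim: n x => [|n IHn] x; first by rewrite /= eq_sym.
case/existsP=> z /andP[xz /IHn yz].
by rewrite -addn1; apply: walkn_cat yz _; rewrite walkn1 adjC.
Qed.

Lemma distC x y : dist w x y = dist w y x.
Proof.
by apply/eqP; rewrite eqn_leq !dist_le //; apply/walkn_sym/dist_walkn.
Qed.

Lemma dist_triangle y x z : (dist w x z <= dist w x y + dist w y z)%N.
Proof. by apply/dist_le/walkn_cat; apply: dist_walkn. Qed.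

Lemma dist_eq0 x y : (dist w x y == 0%N) = (x == y).
Proof.
apply/idP/idP => [/eqP d0|/eqP->]; first by have := dist_walkn x y; rewrite d0.
by rewrite -leqn0 dist_le /=.
Qed.

Lemma distxx x : dist w x x = 0%N.
Proof. by apply/eqP; rewrite dist_eq0. Qed.

Lemma dist_eq1 x y : (dist w x y == 1%N) = adj w x y.
Proof.
apply/eqP/idP => [d1|xy]; first by rewrite -walkn1 -d1 dist_walkn.
apply/eqP; rewrite eqn_leq dist_le ?walkn1 // lt0n dist_eq0.
by apply: contraL xy => /eqP->; rewrite adjxx.
Qed.

Lemma dist_adj x y z : adj w x y -> (dist w x z <= (dist w y z).+1)%N.
Proof.
by rewrite -dist_eq1 => /eqP xy; have := dist_triangle y x z; rewrite xy.
Qed.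

Lemma dist_pred x y n : dist w x y = n.+1 -> exists2 z, adj w x z & dist w z y = n.
Proof.
move=> dn; have := dist_walkn x y; rewrite dn => /existsP[z /andP[xz /dist_le zy]].
by exists z => //; apply/eqP; rewrite eqn_leq zy -ltnS -dn dist_adj.
Qed.

Lemma exists_adj x : (1 < #|V|)%N -> exists y, adj w x y.
Proof.
move=> V1; have [y xy] : exists y, y != x.
  by apply/existsP; move: V1; apply: contraTT; rewrite negb_exists => /forallP H;
     rewrite -leqNgt -(card1 x) subset_leq_card //; apply/subsetP => y _;
     have := H y; rewrite negbK.
case E : (dist w x y) => [|n]; last by have [z] := dist_pred E; exists z.
by move/eqP: E; rewrite dist_eq0 eq_sym (negPf xy).
Qed.

(** A connected bipartite graph has just two proper 2-colourings, exchanged by swapping colours, so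
    [c] is the parity of the distance to [x0] up to a swap. This is how bipartiteness excludes edges
    inside a level. *)
Lemma coloring_dist (c : V -> bool) : (forall x y, adj w x y -> c x != c y) ->
  forall x0 u, c u = odd (dist w u x0) (+) c x0.
Proof.
move=> cP x0 u; have [k] := ubnP (dist w u x0); elim: k u => // k IHk u uk.
case du : (dist w u x0) => [|n].
  by move/eqP: du; rewrite dist_eq0 => /eqP->.
have [z uz dz] := dist_pred du.
have := cP _ _ uz; rewrite (IHk z) ?dz; last by lia.
by rewrite /=; case: (c u) (odd n) (c x0) => [] [] [].
Qed.

End Distance.

Section Calculus.
Variables (R : realFieldType) (V : finType) (w : V -> V -> R) (m : V -> R).

(** The jump rates of the Markov chain generated by Delta. *)
Definition rate x y : R := w x y / m x.
Local Notation p := rate.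
Local Notation Delta := (Lap w m).
Local Notation Gamma := (Gam w m).
Local Notation Gamma2 := (Gam2 w m).

Lemma LapE f x : Delta f x = \sum_y p x y * (f y - f x).
Proof.
by rewrite /Lap mulr_sumr; apply: eq_bigr => y _; rewrite /rate mulrCA -mulrA; ring.
Qed.

Lemma DegE x : Deg w m x = \sum_y p x y.
Proof. by rewrite /Deg mulr_sumr; apply: eq_bigr => y _; rewrite mulrC. Qed.

Lemma GamE f g x :
  Gamma f g x = (\sum_y p x y * ((f y - f x) * (g y - g x))) / 2%:R.
Proof.
rewrite /Gam !LapE !mulr_sumr -!sumrB; congr (_ / _).
by apply: eq_bigr => y _; ring.
Qed.

Lemma GamffE f x : 2%:R * Gamma f f x = \sum_y p x y * (f y - f x) ^+ 2.
Proof. by rewrite GamE mulrC divfK ?pnatr_eq0. Qed.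

Lemma GamC f g x : Gamma f g x = Gamma g f x.
Proof. by rewrite !GamE; congr (_ / _); apply: eq_bigr => y _; ring. Qed.

Lemma eq_Lap f g : f =1 g -> Delta f =1 Delta g.
Proof. by move=> fg x; rewrite !LapE; apply: eq_bigr => y _; rewrite !fg. Qed.

Lemma eq_Gam f f' g g' : f =1 f' -> g =1 g' -> Gamma f g =1 Gamma f' g'.
Proof.
by move=> ff gg x; rewrite !GamE; congr (_ / _); apply: eq_bigr => y _; rewrite !ff !gg.
Qed.

Lemma LapD a b f g x :
  Delta (fun v => a * f v + b * g v) x = a * Delta f x + b * Delta g x.
Proof.
by rewrite !LapE !mulr_sumr -big_split; apply: eq_bigr => y _ /=; ring.
Qed.

Lemma GamDl a b f g h x :
  Gamma (fun v => a * f v + b * g v) h x = a * Gamma f h x + b * Gamma g h x.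
Proof.
rewrite !GamE !mulrA -mulrDl !mulr_sumr -big_split; congr (_ / _).
by apply: eq_bigr => y _ /=; ring.
Qed.

Lemma GamDr a b f g h x :
  Gamma h (fun v => a * f v + b * g v) x = a * Gamma h f x + b * Gamma h g x.
Proof. by rewrite GamC GamDl !(GamC h). Qed.

Lemma GamDcr f g (c : R) x : Gamma f (fun v => g v + c) x = Gamma f g x.
Proof. by rewrite !GamE; congr (_ / _); apply: eq_bigr => y _ /=; ring. Qed.

Lemma Gam2D f g t x :
  Gamma2 (fun v => f v + t * g v) (fun v => f v + t * g v) x =
  Gamma2 f f x + 2%:R * t * Gamma2 f g x + t ^+ 2 * Gamma2 g g x.
Proof.
rewrite /Gam2.
pose u := fun v => 1 * f v + t * g v.
have E : (fun v => f v + t * g v) =1 u by move=> v; rewrite /u mul1r.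
have Eg : (fun z => Gamma (fun v => f v + t * g v) (fun v => f v + t * g v) z) =1
   fun z => 1 * (1 * Gamma f f z + (2%:R * t) * Gamma f g z) + t ^+ 2 * Gamma g g z.
  by move=> z; rewrite (eq_Gam E E) /u !GamDl !GamDr (GamC g f); ring.
rewrite (eq_Lap Eg) !LapD.
have EL : Delta (fun v => f v + t * g v) =1 fun v => 1 * Delta f v + t * Delta g v.
  by move=> v; rewrite (eq_Lap E) LapD.
rewrite (eq_Gam E EL) !GamDl !GamDr; by field.
Qed.

Lemma Gam2DC f g x : Gamma2 f g x = Gamma2 g f x.
Proof.
rewrite /Gam2 (eq_Lap (g := fun z => Gamma g f z)); last by move=> z; rewrite GamC.
by congr (_ / _); ring.
Qed.

Hypothesis wG : weighted_graph w m.
Hypothesis conn : connected w.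

Lemma wC x y : w x y = w y x. Proof. by case: wG. Qed.
Lemma w0 x : w x x = 0. Proof. by case: wG. Qed.
Lemma m_gt0 x : 0 < m x. Proof. by case: wG. Qed.

Lemma rate_ge0 x y : 0 <= p x y.
Proof. by case: wG => w_ge0 _ _ m0; rewrite divr_ge0 // ltW. Qed.

Lemma rate_gt0 x y : (0 < p x y) = adj w x y.
Proof. by rewrite /rate pmulr_lgt0 // invr_gt0 m_gt0. Qed.

Lemma rate_eq0 x y : ~~ adj w x y -> p x y = 0.
Proof. by rewrite -rate_gt0 -leNgt => ?; apply/eqP; rewrite eq_le rate_ge0 andbT. Qed.

Lemma rate_sum0 x (F : V -> R) : (forall y, adj w x y -> 0 <= F y) ->
  \sum_y p x y * F y <= 0 -> forall y, adj w x y -> F y = 0.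
Proof.
move=> F0 S0.
have T0 y : 0 <= p x y * F y.
  case: (boolP (adj w x y)) => [xy|/rate_eq0->]; last by rewrite mul0r.
  by rewrite mulr_ge0 ?rate_ge0 ?F0.
have /eqP : \sum_y p x y * F y = 0 by apply/eqP; rewrite eq_le S0 sumr_ge0.
rewrite psumr_eq0 // => /allP H y xy.
have := H y; rewrite mem_index_enum => /(_ isT) /=.
by rewrite mulf_eq0 gt_eqF ?rate_gt0 //= => /eqP.
Qed.

Lemma eq_rate_sum x (F G : V -> R) : (forall y, adj w x y -> F y = G y) ->
  \sum_y p x y * F y = \sum_y p x y * G y.
Proof.
move=> FG; apply: eq_bigr => y _.
by case: (boolP (adj w x y)) => [/FG->|/rate_eq0->]; rewrite ?mul0r.
Qed.

Lemma Gam_ge0 f x : 0 <= Gamma f f x.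
Proof.
rewrite GamE divr_ge0 ?ler0n // sumr_ge0 // => y _.
by rewrite mulr_ge0 ?rate_ge0 // -expr2 sqr_ge0.
Qed.

Lemma adj_const (T : Type) (f : V -> T) :
  (forall x y, adj w x y -> f y = f x) -> forall x y, f y = f x.
Proof.
move=> H x y; have /connectP[s ps ->] := conn x y.
by elim: s x ps => //= z s IHs x /andP[xz ps]; rewrite IHs // (H _ _ xz).
Qed.

Lemma Gam_eq0 f x : Gamma f f x = 0 -> forall y, adj w x y -> f y = f x.
Proof.
move=> G0 y xy; apply/eqP; rewrite -subr_eq0 -sqrf_eq0.
apply/eqP; move: y xy; apply: rate_sum0 => [y _|]; first exact: sqr_ge0.
by rewrite -GamffE G0 mulr0.
Qed.

Lemma Gam0_const f : (forall x, Gamma f f x = 0) -> forall x y, f y = f x.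
Proof. by move=> G0; apply: adj_const => x y; apply: Gam_eq0. Qed.

Lemma Lap_max g x : (forall y, g y <= g x) -> Delta g x <= 0.
Proof.
move=> gx; rewrite LapE sumr_le0 // => y _.
by rewrite mulr_ge0_le0 ?rate_ge0 ?subr_le0.
Qed.

Lemma exists_max (g : V -> R) : V -> exists x, forall y, g y <= g x.
Proof.
move=> x0; have [x _ xP] := @arg_maxP _ R V x0 xpredT g isT.
by exists x => y; apply: xP.
Qed.

(** Maximum principle: at a maximum no summand of [Delta g] is positive, so nonnegativity of the sum
    makes every neighbour a maximum too, and paths carry this everywhere. *)
Lemma subharmonic_const g : (forall x, 0 <= Delta g x) -> forall x y, g y = g x.
Proof.
move=> gh x0 y0; have [a aP] := exists_max g x0.
suff H x : g x = g a by rewrite !H.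
have /connectP[s ps ->] := conn a x.
elim: s {x} a aP ps => //= z s IHs a aP /andP[az ps].
have gz : g z = g a.
  apply/eqP; rewrite eq_sym -subr_eq0; apply/eqP; move: z az {ps}.
  apply: (@rate_sum0 _ (fun z => g a - g z)) => [z _|]; first by rewrite subr_ge0.
  rewrite -oppr_ge0 -sumrN (le_trans (gh a)) // LapE le_eqVlt; apply/orP; left.
  by apply/eqP/eq_bigr => z _; ring.
by rewrite IHs // => y; rewrite gz.
Qed.

Lemma Lap_const_eq0 (c : R) v : V -> (forall x, Delta v x = c) -> c = 0.
Proof.
move=> x0 vc; apply/eqP; rewrite eq_le; apply/andP; split.
  by have [a aP] := exists_max v x0; rewrite -(vc a) Lap_max.
(* A minimum of [v] is a maximum of [-v], written as a linear combination to suit [LapD]. *)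
have [a aP] := exists_max (fun x => 0 * v x + -1 * v x) x0.
by have := Lap_max aP; rewrite LapD vc; lra.
Qed.

(** Completing the square: the weighted sum of [(f y - f x - 1) ^+ 2] is nonnegative and equals
    [2 Gamma f - 2 Delta f + Deg] at [x]. *)
Lemma Lap_bound f x (D : R) : 2%:R * Gamma f f x <= D -> Deg w m x <= D ->
  Delta f x <= D.
Proof.
move=> fD xD.
have : 0 <= \sum_y p x y * (f y - f x - 1) ^+ 2.
  by apply: sumr_ge0 => y _; rewrite mulr_ge0 ?rate_ge0 ?sqr_ge0.
suff -> : \sum_y p x y * (f y - f x - 1) ^+ 2 =
   2%:R * Gamma f f x - 2%:R * Delta f x + Deg w m x by lra.
rewrite GamffE LapE DegE mulr_sumr -sumrB -big_split.
by apply: eq_bigr => y _ /=; ring.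
Qed.

(** Equality in [Lap_bound] leaves no slack in [Deg x <= D] and makes every square vanish. *)
Lemma Lap_bound_eq f x (D : R) : 2%:R * Gamma f f x <= D -> Deg w m x <= D ->
  Delta f x = D -> Deg w m x = D /\ forall y, adj w x y -> f y = f x + 1.
Proof.
move=> fD xD fx.
have E : \sum_y p x y * (f y - f x - 1) ^+ 2 =
   2%:R * Gamma f f x - 2%:R * Delta f x + Deg w m x.
  rewrite GamffE LapE DegE mulr_sumr -sumrB -big_split.
  by apply: eq_bigr => y _ /=; ring.
have E0 : 0 <= \sum_y p x y * (f y - f x - 1) ^+ 2.
  by apply: sumr_ge0 => y _; rewrite mulr_ge0 ?rate_ge0 ?sqr_ge0.
split; first by apply/eqP; rewrite eq_le xD /=; lra.
move=> y xy; have /eqP : (f y - f x - 1) ^+ 2 = 0.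
  apply: (@rate_sum0 x (fun y => (f y - f x - 1) ^+ 2)) xy => [z _|].
    exact: sqr_ge0.
  by lra.
by rewrite sqrf_eq0 => /eqP; lra.
Qed.

Lemma Deg_le x : Deg w m x <= Degmax w m.
Proof.
rewrite /Degmax (bigD1 x) //= le_max lexx //.
Qed.

Lemma Degmax_gt0 : (1 < #|V|)%N -> 0 < Degmax w m.
Proof.
move=> V1; have [x _] : exists x : V, true.
  by case: (pickP (fun _ : V => true)) => [x|/eq_card0 H];
    [exists x | rewrite H in V1].
have [y xy] := exists_adj w0 conn x V1.
apply: lt_le_trans (Deg_le x); rewrite DegE (bigD1 y) //=.
by rewrite ltr_pwDl ?rate_gt0 // sumr_ge0 // => z _; apply: rate_ge0.
Qed.

End Calculus.

(** * Eigenfunctions and contraction under CD(K,oo) *)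

Section Curvature.
Variables (R : realFieldType) (V : finType) (w : V -> V -> R) (m : V -> R) (K : R).
Hypothesis wG : weighted_graph w m.
Hypothesis conn : connected w.
Hypothesis K0 : 0 < K.
Hypothesis CD : CDinf w m K.

Local Notation p := (rate w m).
Local Notation Delta := (Lap w m).
Local Notation Gamma := (Gam w m).
Local Notation Gamma2 := (Gam2 w m).
Local Notation D := (Degmax w m).
Local Notation d := (dist w).
Let wC := wC wG.
Let w0 := w0 wG.

Definition eigenfun (lam : R) (f : V -> R) := forall x, Delta f x = - (lam * f x).

Lemma Gam2_eigen lam f g x : eigenfun lam f ->
  2%:R * Gamma2 f g x =
  Delta (Gamma f g) x - Gamma f (Delta g) x + lam * Gamma g f x.
Proof.
move=> fE; rewrite /Gam2 mulrC divfK ?pnatr_eq0 //.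
have -> : Gamma g (Delta f) x = - (lam * Gamma g f x).
  rewrite (@eq_Gam _ _ w m g g (Delta f) (fun v => 0 * f v + (- lam) * f v)) //.
    by rewrite GamDr; ring.
  by move=> v; rewrite fE; ring.
by rewrite opprK.
Qed.

Lemma Gam2_eigen_diag lam f x : eigenfun lam f ->
  2%:R * Gamma2 f f x = Delta (Gamma f f) x + 2%:R * lam * Gamma f f x.
Proof.
move=> fE; rewrite (Gam2_eigen _ _ fE).
have -> : Gamma f (Delta f) x = - (lam * Gamma f f x).
  rewrite (@eq_Gam _ _ w m f f (Delta f) (fun v => 0 * f v + (- lam) * f v)) //.
    by rewrite GamDr; ring.
  by move=> v; rewrite fE; ring.
by ring.
Qed.

Lemma eigen_Gam_const f : eigenfun K f -> forall x y, Gamma f f y = Gamma f f x.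
Proof.
move=> fE; apply: (subharmonic_const wG conn) => x.
by have := CD f x; have := Gam2_eigen_diag x fE; lra.
Qed.

(** Lichnerowicz estimate: at a maximum of [Gamma f], [Delta (Gamma f) <= 0], hence
    [K Gamma f <= Gamma2 f <= lam Gamma f] there. If that maximum is 0, then [f] is constant. *)
Lemma lichnerowicz lam f : V -> eigenfun lam f ->
  [\/ forall x, f x = 0, lam = 0 | K <= lam].
Proof.
move=> x0 fE; have [x xP] := exists_max (Gamma f f) x0.
have := Lap_max wG xP; have := CD f x; have := Gam2_eigen_diag x fE => E1 E2 E3.
have: 0 <= Gamma f f x by exact: Gam_ge0 wG _ _.
rewrite le_eqVlt => /orP[/eqP E|Gx].
  have fC := @Gam0_const _ _ _ _ wG conn f.
  have {}fC : forall x y, f y = f x.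
    by apply: fC => y; apply/eqP; rewrite eq_le (Gam_ge0 wG) E xP.
  have [->|lam0] := eqVneq lam 0; first by constructor 2.
  constructor 1 => y; have := fE y; rewrite LapE.
  rewrite big1 => [/esym/eqP|z _]; last by rewrite (fC y z) subrr mulr0.
  by rewrite oppr_eq0 mulf_eq0 (negPf lam0) /= => /eqP.
constructor 3; rewrite -(ler_pM2r Gx).
by lra.
Qed.

(** An affine function bounded below on the whole line has slope 0; the chosen [t] would give it the
    value -1. *)
Lemma psd_cross (a b : R) : (forall t : R, 0 <= a + t * b) -> b = 0.
Proof.
move=> H; apply/eqP/negPn/negP => b0.
have := H (- (a + 1) / b); rewrite divfK //; lra.
Qed.

(* [Gamma2 - K Gamma] is a positive semidefinite form vanishing at [f], hence
   [f] is in its kernel. *)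
Lemma eigen_Gam2 f g x : eigenfun K f -> Gamma2 f g x = K * Gamma f g x.
Proof.
move=> fE; apply/eqP; rewrite -subr_eq0; apply/eqP.
have fC := eigen_Gam_const fE.
have E0 : Gamma2 f f x = K * Gamma f f x.
  have := Gam2_eigen_diag x fE; rewrite LapE big1 => [|y _]; first by lra.
  by rewrite (fC x y) subrr mulr0.
pose Q := Gamma2 g g x - K * Gamma g g x.
suff : 2%:R * (Gamma2 f g x - K * Gamma f g x) = 0 by lra.
apply: (@psd_cross Q) => t; have := CD (fun v => g v + t * f v) x.
rewrite Gam2D (Gam2DC _ _ g f) E0.
have E : (fun v => g v + t * f v) =1 fun v => 1 * g v + t * f v.
  by move=> v; rewrite mul1r.
by rewrite (eq_Gam w m E E) !GamDl !GamDr (GamC _ _ g f) /Q; lra.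
Qed.

(** Pair [f] with the indicator [h] of [z] in [eigen_Gam2]. As [z] is not adjacent to [x],
    [Gamma f h] vanishes at [x], and only two-step paths from [x] to [z] contribute: second
    differences of [f] along them average to 0. *)
Lemma eigen_second_sphere f x z : eigenfun K f -> d z x = 2%N ->
  \sum_y p x y * (p y z * (f z - f y - (f y - f x))) = 0.
Proof.
move=> fE zx2; have zx : z != x by rewrite -(dist_eq0 conn) zx2.
have nxz : ~~ adj w x z by rewrite (adjC wC) -(dist_eq1 w0 conn) zx2.
pose h v : R := (v == z)%:R.
have hx : h x = 0 by rewrite /h eq_sym (negPf zx).
have Gx : Gamma f h x = 0.
  rewrite GamE (eq_rate_sum wG (G := fun=> 0)) => [|y xy].
    by rewrite big1 ?mul0r // => y _; rewrite mulr0.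
  rewrite hx /h; case: eqP => [yz|_]; last by rewrite subr0 mulr0.
  by rewrite -yz xy in nxz.
have Dh y : y != z -> Delta h y = p y z.
  move=> yz; rewrite LapE (bigD1 z) //= big1 => [|v /negPf vz].
    by rewrite /h eqxx (negPf yz) subr0 mulr1 addr0.
  by rewrite /h vz (negPf yz) subr0 mulr0.
have Gy y : y != z -> 2%:R * Gamma f h y = p y z * (f z - f y).
  move=> yz; rewrite GamE mulrC divfK ?pnatr_eq0 //.
  rewrite (bigD1 z) //= big1 => [|v /negPf vz].
    by rewrite /h eqxx (negPf yz) subr0 mulr1 addr0.
  by rewrite /h vz (negPf yz) subr0 !mulr0.
have := Gam2_eigen h x fE; rewrite (eigen_Gam2 h x fE) (GamC _ _ h) Gx !mulr0 addr0.
rewrite LapE Gx [Gamma f (Delta h) x]GamE.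
rewrite (Dh x) 1?eq_sym // (rate_eq0 wG nxz) => E.
transitivity (2%:R * (\sum_y p x y * (Gamma f h y - 0) -
   (\sum_y p x y * ((f y - f x) * (Delta h y - 0))) / 2%:R)); last by rewrite -E mulr0.
rewrite mulrBr [2%:R * (_ / _)]mulrC divfK ?pnatr_eq0 // mulr_sumr -sumrB.
apply: eq_bigr => y _; case: (boolP (adj w x y)) => [xy|/(rate_eq0 wG)->].
  have yz : y != z by apply: contraNneq nxz => <-.
  transitivity (p x y * (2%:R * Gamma f h y) - p x y * ((f y - f x) * p y z)).
    by rewrite Gy //; ring.
  by rewrite Dh //; ring.
by rewrite !mul0r mulr0 subrr.
Qed.

(** * Shell structure from an eigenfunction with unit increments at [x0] *)

Section FromEigenfunction.
Variables (f : V -> R) (x0 : V).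
Hypothesis fE : eigenfun K f.
Hypothesis f1 : forall y, adj w x0 y -> f y = f x0 + 1.
Hypothesis Dx0 : Deg w m x0 = D.

Lemma eigenfun_dist x : f x = f x0 + (d x x0)%:R.
Proof.
have [k] := ubnP (d x x0); elim: k x => // k IHk z.
case E : (d z x0) => [|[|n]] lt_k.
- by move/eqP: E; rewrite (dist_eq0 conn) => /eqP->; rewrite addr0.
- rewrite f1 //; by rewrite (adjC wC) -(dist_eq1 w0 conn) E.
have [y zy yn] := dist_pred w0 conn E.
have [x yx xn] := dist_pred w0 conn yn.
have zx2 : d z x = 2%N.
  apply/eqP; rewrite eqn_leq; apply/andP; split.
    by apply: dist_le => //; apply: (@walkn_cat _ _ _ 1 1 _ y); rewrite walkn1.
  by have := dist_triangle conn x z x0; lia.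
have := eigen_second_sphere fE zx2.
set c := f z - (f x0 + n.+2%:R).
(* All midpoints of paths from [x] to [z] lie on level [n.+1], where [f] is known by induction. So
   each path sees the same error [c] in the predicted value of [f z]; the total path weight is
   positive, hence [c = 0]. *)
have step u : adj w x u -> p u z * (f z - f u - (f u - f x)) = p u z * c.
  move=> xu; case: (boolP (adj w u z)) => [uz|/(rate_eq0 wG)->]; last by rewrite !mul0r.
  have un : d u x0 = n.+1.
    apply/eqP; rewrite eqn_leq.
    have ux : adj w u x by rewrite (adjC wC).
    have zu : adj w z u by rewrite (adjC wC).
    by have := dist_adj w0 conn x0 ux; have := dist_adj w0 conn x0 zu; lia.
  rewrite (IHk u) ?(IHk x) ?un ?xn; [|lia|lia].
  by rewrite /c -!natr1; ring.
rewrite (eq_rate_sum wG step).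
under eq_bigr do rewrite mulrA; rewrite -mulr_suml => /eqP.
rewrite mulf_eq0 gt_eqF /=.
  by rewrite /c subr_eq0 => /eqP.
rewrite (bigD1 y) //= ltr_pwDl //.
  by rewrite mulr_gt0 ?(rate_gt0 wG) // (adjC wC).
by rewrite sumr_ge0 // => u _; rewrite mulr_ge0 ?(rate_ge0 wG).
Qed.

Lemma eigenfun_Gam x : 2%:R * Gamma f f x = D.
Proof.
rewrite (eigen_Gam_const fE x0 x) GamffE -Dx0 DegE.
rewrite (eq_rate_sum wG (G := fun=> 1)) => [|y /f1->].
  by apply: eq_bigr => y _; rewrite mulr1.
by rewrite addrC addKr expr1n.
Qed.

Lemma adj_dist_leq x y : adj w x y -> (d x x0 <= (d y x0).+1)%N /\ (d y x0 <= (d x x0).+1)%N.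
Proof.
by move=> xy; split; apply: (dist_adj w0 conn) => //; rewrite (adjC wC).
Qed.

Lemma eigenfun_sqr x y : adj w x y -> (f y - f x) ^+ 2 = (d x x0 != d y x0)%:R.
Proof.
move=> /adj_dist_leq[xy yx]; rewrite (eigenfun_dist x) (eigenfun_dist y).
have [->|ne] := eqVneq (d x x0) (d y x0); first by rewrite subrr expr0n.
have [E|E] : d y x0 = (d x x0).+1 \/ d x x0 = (d y x0).+1 by lia.
  by rewrite E -natr1 /=; ring.
by rewrite E -natr1 /=; ring.
Qed.

(** Increments of [f] are 0 or of size 1, so [2 Gamma f = D] is the rate towards other levels. The
    rate inside the level is then [Deg x - D], both nonnegative and nonpositive. *)
Lemma eigenfun_Deg_dist x : Deg w m x = D /\ forall y, adj w x y -> d x x0 != d y x0.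
Proof.
have E : \sum_y p x y * (d x x0 == d y x0)%:R = Deg w m x - D.
  rewrite -(eigenfun_Gam x) GamffE DegE -sumrB.
  under [in RHS]eq_bigr => y _ do rewrite -[p x y]mulr1 -mulrA -mulrBr mul1r.
  apply: eq_rate_sum => // y xy; rewrite eigenfun_sqr //.
  by case: eqP => _; rewrite ?subr0 ?subrr.
have xD := Deg_le w m x.
split.
  apply/eqP; rewrite eq_le xD -subr_ge0 -E sumr_ge0 // => y _.
  by rewrite mulr_ge0 ?(rate_ge0 wG) ?ler0n.
move=> y xy; suff /eqP : (d x x0 == d y x0)%:R = 0 :> R by rewrite pnatr_eq0 eqb0.
apply: (rate_sum0 wG (F := fun y => (d x x0 == d y x0)%:R)) xy => [z _|].
  exact: ler0n.
by rewrite E subr_le0.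
Qed.

Lemma dminusE x : dminus w m x0 x = \sum_y p x y * (d y x0 < d x x0)%:R.
Proof.
rewrite /dminus big_mkcond; apply: eq_bigr => y _ /=.
rewrite (adjC wC) /rate (wC y); case: (boolP (adj w x y)) => [xy|nxy] /=.
  by case: ltnP; rewrite ?mulr1 ?mulr0.
by rewrite -/(rate w m x y) (rate_eq0 wG) ?mul0r.
Qed.

Lemma eigenfun_HSS : (1 < #|V|)%N -> HSS_at w m (2%:R * D / K) (K / 2%:R) x0.
Proof.
move=> V1; have D0 := Degmax_gt0 wG conn V1.
split.
- by rewrite divr_gt0 // mulr_gt0 ?ltr0n.
- by rewrite divr_gt0 ?ltr0n.
- move=> x; rewrite (eigenfun_Deg_dist x).1; field; exact: lt0r_neq0.
- exists (fun x => odd (d x x0)) => x y xy.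
  have := (eigenfun_Deg_dist x).2 y xy; have := adj_dist_leq xy; lia.
move=> x; rewrite dminusE; have := fE x; rewrite LapE.
(* Every neighbour is one level up or one level down, so [Delta f] is the full rate minus twice the
   backward rate. *)
have -> : \sum_y p x y * (f y - f x) =
   \sum_y p x y * 1 - 2%:R * \sum_y p x y * (d y x0 < d x x0)%:R.
  rewrite mulr_sumr -sumrB.
  transitivity (\sum_y p x y * (1 - 2%:R * (d y x0 < d x x0)%:R)); last first.
    by apply: eq_bigr => y _; ring.
  apply: eq_rate_sum => // y xy; rewrite (eigenfun_dist x) (eigenfun_dist y).
  have := (eigenfun_Deg_dist x).2 y xy; have [] := adj_dist_leq xy => H1 H2 H3.
  have [E|E] : d y x0 = (d x x0).+1 \/ d x x0 = (d y x0).+1 by lia.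
    by rewrite E ltnNge leqnSn /= -natr1; ring.
  by rewrite E ltnS leqnn /= -natr1; ring.
under eq_bigr do rewrite mulr1; rewrite -DegE (eigenfun_Deg_dist x).1.
(* At [x0] the eigenvalue equation reads [D = - K f x0], which fixes the additive constant of
   [f]. *)
have := fE x0; rewrite LapE (eq_rate_sum wG (G := fun=> 1)) => [|y /f1->]; last by ring.
under eq_bigr do rewrite mulr1; rewrite -DegE Dx0 (eigenfun_dist x).
by lra.
Qed.

End FromEigenfunction.

Lemma Gam_affine (g f : V -> R) (a b c : R) :
  (forall x, g x = a * f x + b * Delta f x + c) -> forall x,
  Gamma g g x = a ^+ 2 * Gamma f f x + 2%:R * a * b * Gamma f (Delta f) x
    + b ^+ 2 * Gamma (Delta f) (Delta f) x.
Proof.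
move=> E x; pose h v := a * f v + b * Delta f v.
have {}E : g =1 fun v => h v + c by [].
by rewrite (eq_Gam w m E E) GamDcr GamC GamDcr GamDl !GamDr (GamC _ _ _ f); ring.
Qed.

(* The inverse of [u |-> a u - (1 - a) / K Delta u] contracts the supremum of
   [Gamma]. At a maximum [x] of [Gamma u], the curvature bound gives
   [- Gamma (u, Delta u) >= K Gamma u], and [Gamma (Delta u + K u) >= 0] then
   bounds [Gamma (Delta u)] from below by [K ^ 2 Gamma u]. *)
Lemma Gam_contraction (a c C : R) u g : 0 <= a -> a <= 1 ->
  (forall x, g x = a * u x + (a - 1) / K * Delta u x + c) ->
  (forall x, Gamma g g x <= C) -> forall x, Gamma u u x <= C.
Proof.
move=> a0 a1 gE gC x1; have [x xP] := exists_max (Gamma u u) x1.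
apply: le_trans (xP x1) (le_trans _ (gC x)).
rewrite (Gam_affine gE).
set s := Gamma u (Delta u) x; set r := Gamma (Delta u) (Delta u) x.
set q := Gamma u u x.
have H1 : K * q <= - s.
  by have := CD u x; have := Lap_max wG xP; rewrite /Gam2 -/s -/q; lra.
have H2 : 0 <= r + 2%:R * K * s + K ^+ 2 * q.
  have := Gam_ge0 wG (fun v => K * u v + 1 * Delta u v) x.
  by rewrite GamDl !GamDr (GamC _ _ _ u) -/q -/s -/r; lra.
pose s' := s / K; pose r' := r / K ^+ 2.
have Ks : s = K * s' by rewrite mulrC divfK ?lt0r_neq0.
have Kr : r = K ^+ 2 * r' by rewrite mulrC divfK // expf_neq0 ?lt0r_neq0.
have {H1}H1 : q <= - s' by rewrite -(ler_pM2l K0) mulrN -Ks.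
have {H2}H2 : 0 <= r' + 2%:R * s' + q.
  rewrite -(pmulr_rge0 _ (exprn_gt0 2 K0)).
  by rewrite Ks Kr in H2; lra.
have -> : a ^+ 2 * q + 2%:R * a * ((a - 1) / K) * s + ((a - 1) / K) ^+ 2 * r =
  a ^+ 2 * q - 2%:R * a * (1 - a) * s' + (1 - a) ^+ 2 * r'.
  by rewrite Ks Kr; field; exact: lt0r_neq0.
(* The right side minus [q] is exactly the quantity in [H3] plus twice the one in [H4]. *)
have H3 : 0 <= (1 - a) ^+ 2 * (r' + 2%:R * s' + q) by rewrite mulr_ge0 ?sqr_ge0.
have H4 : 0 <= (1 - a) * (- s' - q) by rewrite mulr_ge0 ?subr_ge0.
by nra.
Qed.

End Curvature.

(** * Semisimple matrices *)

Section LinearAlgebra.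
Variable F : fieldType.

Lemma inj_mx_surj n (B : 'M[F]_n) : (forall v : 'rV_n, v *m B = 0 -> v = 0) ->
  forall u : 'rV_n, exists v, v *m B = u.
Proof.
move=> /inj_row_free; rewrite row_free_unit => Bu u.
by exists (u *m invmx B); rewrite mulmxKV.
Qed.

(** No Jordan block at [a] has size greater than 1; this holds trivially if [a] is not an
    eigenvalue. *)
Definition semisimple_at n (A : 'M[F]_n) (a : F) :=
  forall v : 'rV_n, v *m (A - a%:M) *m (A - a%:M) = 0 -> v *m (A - a%:M) = 0.

Lemma semisimple_expr n (A : 'M[F]_n) a k (v : 'rV_n) : semisimple_at A a ->
  v *m (A - a%:M) ^+ k = 0 -> v *m (A - a%:M) = 0.
Proof.
move=> ss; elim: k v => [|k IHk] v; first by rewrite expr0 mulmx1 => ->; rewrite mul0mx.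
rewrite exprS -[_ * _]/(_ *m _) mulmxA => /IHk; exact: ss.
Qed.

Lemma horner_mx_sum n (A : 'M[F]_n.+1) (q : {poly F}) k : (size q <= k)%N ->
  horner_mx A q = \sum_(i < k) q`_i *: A ^+ i.
Proof.
move=> qk; have {1}-> : q = \sum_(i < k) q`_i *: 'X^i.
  rewrite -poly_def; apply/polyP => i; rewrite coef_poly; case: ltnP => // ki.
  by rewrite nth_default // (leq_trans qk).
rewrite rmorph_sum; apply: eq_bigr => i _ /=.
by rewrite linearZ /= rmorphXn /= horner_mx_X.
Qed.

(* The polynomial with coefficients [c] is the part of the characteristic
   polynomial prime to ['X - 1], normalized at [1]. *)
Lemma cyclic_fixpoint n (A : 'M[F]_n) (u : 'rV_n) : semisimple_at A 1 ->
  exists c : nat -> F, \sum_(i < n.+1) c i = 1 /\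
    let v := \sum_(i < n.+1) c i *: (u *m A ^+ i) in v *m A = v.
Proof.
case: n A u => [|n] A u ss.
  exists (fun=> 1); split; first by rewrite big_ord1.
  by apply/rowP => -[].
have [k [q]] := multiplicity_XsubC (char_poly A) 1.
rewrite -size_poly_eq0 size_char_poly /= => nrq pE.
have q1 : q.[1] != 0 by [].
have sq : (size q <= n.+2)%N.
  rewrite -(size_char_poly A) pE size_Mmonic ?monic_exp ?monicXsubC //.
    by rewrite size_exp_XsubC; lia.
  by apply: contraNneq q1 => ->; rewrite horner0.
exists (fun i => q`_i / q.[1]); split.
  rewrite -mulr_suml [X in X / _](_ : _ = q.[1]) ?divff //.
  by rewrite (horner_coef_wide _ sq); apply: eq_bigr => i _; rewrite expr1n mulr1.
set v := \sum_(i < _) _ => /=.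
have vE : v = q.[1]^-1 *: (u *m horner_mx A q).
  rewrite (horner_mx_sum _ sq) mulmx_sumr scaler_sumr; apply: eq_bigr => i _.
  by rewrite -scalemxAr scalerA mulrC.
suff : v *m (A - 1%:M) = 0 by rewrite mulmxBr mulmx1 => /eqP; rewrite subr_eq0 => /eqP.
(* By Cayley-Hamilton [(A - 1) ^+ k] kills [v], since [q] times [('X - 1) ^+ k] is the
   characteristic polynomial; semisimplicity lowers the exponent to 1. *)
apply: (semisimple_expr (k := k) ss).
rewrite vE -scalemxAl -mulmxA.
have -> : (A - 1%:M) ^+ k = horner_mx A (('X - 1%:P) ^+ k).
  by rewrite rmorphXn rmorphB /= horner_mx_X horner_mx_C.
have -> : horner_mx A q *m horner_mx A (('X - 1%:P) ^+ k) = horner_mx A (char_poly A).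
  by rewrite pE rmorphM.
by rewrite Cayley_Hamilton mulmx0 scaler0.
Qed.

Lemma similar_char_poly n (P A B : 'M[F]_n) : P \in unitmx ->
  P *m A = B *m P -> char_poly A = char_poly B.
Proof.
move=> Pu PAB; rewrite /char_poly.
have E : map_mx polyC P *m char_poly_mx A = char_poly_mx B *m map_mx polyC P.
  by rewrite mulmxBr mulmxBl scalar_mxC -!map_mxM PAB.
have /(congr1 (fun M => \det M)) := E; rewrite !det_mulmx mulrC => /mulIf; apply.
by rewrite det_map_mx polyC_eq0; move: Pu; rewrite unitmxE unitfE.
Qed.

Lemma char_poly_tr n (A : 'M[F]_n) : char_poly A^T = char_poly A.
Proof.
rewrite /char_poly -[RHS]det_tr; congr (\det _).
by rewrite /char_poly_mx linearB /= tr_scalar_mx map_trmx.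
Qed.

Lemma mup_prod_XsubC (I : Type) (r : seq I) (f : I -> F) a :
  mup a (\prod_(i <- r) ('X - (f i)%:P)) = count (fun i => f i == a) r.
Proof.
elim: r => [|i r IHr]; first by rewrite big_nil mupNroot // root1.
rewrite big_cons mupM ?IHr ?polyXsubC_eq0 ?monic_neq0 ?monic_prod_XsubC //=.
by rewrite -['X - _]expr1 mup_XsubCX; case: eqP.
Qed.

(** A factor [A - a] occurring twice can be moved next to its copy, since polynomials in [A]
    commute, and semisimplicity then drops one of them. *)
Lemma semisimple_undup n (A : 'M[F]_n.+1) (s : seq F) (v : 'rV_n.+1) :
  (forall a, semisimple_at A a) ->
  v *m horner_mx A (\prod_(a <- s) ('X - a%:P)) = 0 ->
  v *m horner_mx A (\prod_(a <- undup s) ('X - a%:P)) = 0.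
Proof.
move=> ss; elim: s v => //= a s IHs v; rewrite big_cons.
have XaE : horner_mx A ('X - a%:P) = A - a%:M.
  by rewrite rmorphB /= horner_mx_X horner_mx_C.
rewrite rmorphM /= -[_ * _]/(_ *m _) mulmxA => /IHs.
rewrite XaE; case: ifP => [as_|_]; last by rewrite big_cons rmorphM /= XaE -mulmxA.
have /(perm_to_rem) pe : a \in undup s by rewrite mem_undup.
rewrite (perm_big _ pe) /= big_cons; set q := \prod_(_ <- _) _.
rewrite mulrC rmorphM /= XaE.
rewrite -[_ * _]/(_ *m _) !mulmxA => E; apply: ss; rewrite -[RHS]E.
have cA : (A - a%:M) *m horner_mx A q = horner_mx A q *m (A - a%:M).
  rewrite -XaE; transitivity (horner_mx A (('X - a%:P) * q)); first by rewrite rmorphM.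
  by rewrite mulrC rmorphM.
by rewrite -[v *m _ *m horner_mx A q]mulmxA cA !mulmxA.
Qed.

(** By Cayley-Hamilton and [semisimple_undup] the minimal polynomial divides a product of distinct
    linear factors, so [A] is diagonalizable. The rows of [P] with diagonal entry [a], selected by
    [Q], are independent eigenvectors. *)
Lemma count_le_rank_eigenspace n (A : 'M[F]_n) (s : seq F) a :
  (forall a, semisimple_at A a) -> char_poly A = \prod_(x <- s) ('X - x%:P) ->
  (count_mem a s <= \rank (eigenspace A a))%N.
Proof.
case: n A => [|n] A ss pA.
  have := congr1 (fun p : {poly F} => size p) pA; rewrite size_char_poly size_prod_XsubC.
  by case: s {pA}.
have [P Pu [d Pd]] : exists2 P : 'M_n.+1, P \in unitmx & exists d, P *m A = diag_mx d *m P.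
  have /diagonalizableP [P Pu /similar_diagPex[d /(similarP Pu) E]] :
      exists2 rs, uniq rs & mxminpoly A %| \prod_(x <- rs) ('X - x%:P).
    exists (undup s); first exact: undup_uniq.
    apply: mxminpoly_min; apply/row_matrixP => i; rewrite row0 rowE.
    by apply: semisimple_undup => //; rewrite -pA Cayley_Hamilton mulmx0.
  by exists P => //; exists d.
have cA : char_poly A = \prod_(i <- enum 'I_n.+1) ('X - (d 0 i)%:P).
  rewrite (similar_char_poly Pu Pd) char_poly_trig ?diag_mx_is_trig // big_enum /=.
  by apply: eq_bigr => i _; rewrite mxE eqxx mulr1n.
pose I := [pred i | d 0 i == a].
have cI : count_mem a s = #|I|.
  rewrite cardE size_filter -enumT -(mup_prod_XsubC _ (fun i => d 0 i)) -cA pA.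
  by rewrite (mup_prod_XsubC _ id).
rewrite [leqLHS]cI.
pose Q : 'M[F]_(#|I|, n.+1) := rowsub (@enum_val _ I) 1%:M.
have Qf : row_free Q.
  apply: inj_row_free => v vQ; apply/rowP => k; rewrite mxE.
  have := congr1 (fun M : 'rV_n.+1 => M 0 (enum_val k)) vQ; rewrite !mxE => <-.
  rewrite (bigD1 k) //= big1 => [|j jk]; first by rewrite !mxE eqxx mulr1 addr0.
  by rewrite !mxE (inj_eq enum_val_inj) (negPf jk) mulr0.
have <- : \rank (Q *m P) = #|I|.
  by rewrite mxrankMfree ?row_free_unit //; apply/eqP.
apply: mxrankS; apply/eigenspaceP.
rewrite -mulmxA Pd mulmxA scalemxAl; congr (_ *m _).
rewrite mul_mx_diag; apply/matrixP => k j; rewrite !mxE mulrC.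
case: eqP => [<-|_]; last by rewrite !mulr0.
by have := enum_valP k; rewrite inE => /eqP->.
Qed.
End LinearAlgebra.

(** * Sharp diameter bound *)

Section LaplacianMatrix.
Variables (R : realFieldType) (V : finType) (w : V -> V -> R) (m : V -> R).
Hypothesis wG : weighted_graph w m.
Hypothesis conn : connected w.

Local Notation Delta := (Lap w m).
Local Notation L := (negLap_mx w m)^T.

(** Functions are coded as rows because [eigenspace] consists of row vectors; this is also why [L]
    is a transpose. *)
Definition fun_of_row (v : 'rV[R]_#|V|) (x : V) : R := v 0 (enum_rank x).
Definition row_of_fun (f : V -> R) : 'rV[R]_#|V| := \row_i f (enum_val i).

Lemma row_of_funK f : fun_of_row (row_of_fun f) =1 f.
Proof. by move=> x; rewrite /fun_of_row mxE enum_rankK. Qed.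

Lemma fun_of_row_inj u v : fun_of_row u =1 fun_of_row v -> u = v.
Proof.
move=> uv; apply/rowP => i; have := uv (enum_val i).
by rewrite /fun_of_row enum_valK.
Qed.

Lemma fun_of_row_lin a u b v x :
  fun_of_row (a *: u + b *: v) x = a * fun_of_row u x + b * fun_of_row v x.
Proof. by rewrite /fun_of_row !mxE. Qed.

Lemma fun_of_rowZ a u x : fun_of_row (a *: u) x = a * fun_of_row u x.
Proof. by rewrite /fun_of_row !mxE. Qed.

Lemma fun_of_row_sum n (c : 'I_n -> R) (u : 'I_n -> 'rV_#|V|) x :
  fun_of_row (\sum_i c i *: u i) x = \sum_i c i * fun_of_row (u i) x.
Proof. by rewrite /fun_of_row summxE; apply: eq_bigr => i _; rewrite !mxE. Qed.

Lemma fun_of_row_Lap v x : fun_of_row (v *m L) x = - Delta (fun_of_row v) x.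
Proof.
rewrite /fun_of_row mxE LapE (reindex_onto enum_rank enum_val) /=; last first.
  by move=> i _; rewrite enum_valK.
under eq_bigl do rewrite enum_rankK eqxx.
rewrite -sumrN.
under eq_bigr do rewrite !mxE !enum_rankK mulrBr.
rewrite sumrB (bigD1 x) //= eqxx big1 ?addr0; last first.
  by move=> y /negPf yx; rewrite (inj_eq enum_rank_inj) eq_sym yx mulr0.
rewrite DegE mulr_sumr -sumrB; apply: eq_bigr => y _ /=.
by rewrite /rate; ring.
Qed.

Lemma Lap_selfadjoint (f g : V -> R) :
  \sum_x m x * (Delta f x * g x) = \sum_x m x * (f x * Delta g x).
Proof.
have H u v : \sum_x m x * (Delta u x * v x) =
    \sum_x \sum_y w x y * (u y * v x) - \sum_x \sum_y w x y * (u x * v x).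
  rewrite -sumrB; apply: eq_bigr => x _.
  rewrite LapE mulr_suml mulr_sumr -sumrB; apply: eq_bigr => y _.
  by rewrite /rate; field; rewrite gt_eqF ?(m_gt0 wG).
rewrite H; under [RHS]eq_bigr do rewrite [f _ * _]mulrC.
rewrite H; congr (_ - _); last first.
  by apply: eq_bigr => x _; apply: eq_bigr => y _; rewrite [f x * _]mulrC.
rewrite exchange_big; apply: eq_bigr => x _; apply: eq_bigr => y _ /=.
by rewrite (wC wG) [f x * _]mulrC.
Qed.

(** [A] is self-adjoint for the inner product weighted by [m]. If [u = v (A - a)] and
    [u (A - a) = 0], then moving one factor across gives [<u, u> = <u (A - a), v> = 0]. *)
Lemma semisimple_Lap (A : 'M[R]_#|V|) (s t a : R) :
  (forall v x, fun_of_row (v *m A) x = s * fun_of_row v x + t * Delta (fun_of_row v) x) ->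
  semisimple_at A a.
Proof.
move=> AE v; have BE u x : fun_of_row (u *m (A - a%:M)) x =
    (s - a) * fun_of_row u x + t * Delta (fun_of_row u) x.
  rewrite mulmxBr mul_mx_scalar -scaleNr -[X in fun_of_row (X + _)]scale1r.
  by rewrite fun_of_row_lin AE mul1r mulNr mulrBl addrAC.
move: (v *m (A - a%:M)) (BE v) => u uE uB.
have S0 : \sum_x m x * fun_of_row u x ^+ 2 = 0.
  transitivity (\sum_x m x * (fun_of_row (u *m (A - a%:M)) x * fun_of_row v x)); last first.
    by rewrite uB; apply: big1 => x _; rewrite /fun_of_row mxE mul0r mulr0.
  transitivity ((s - a) * (\sum_x m x * (fun_of_row u x * fun_of_row v x))
    + t * (\sum_x m x * (fun_of_row u x * Delta (fun_of_row v) x))).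
    rewrite !mulr_sumr -big_split; apply: eq_bigr => x _ /=.
    by rewrite expr2 {2}uE; ring.
  rewrite -Lap_selfadjoint !mulr_sumr -big_split; apply: eq_bigr => x _ /=.
  by rewrite BE; ring.
apply: fun_of_row_inj => x; rewrite [RHS]mxE.
move/eqP: S0; rewrite psumr_eq0 => [/allP /(_ x)|y _]; last first.
  by rewrite mulr_ge0 ?sqr_ge0 // ltW ?(m_gt0 wG).
rewrite mem_index_enum => /(_ isT) /=.
by rewrite mulf_eq0 gt_eqF ?(m_gt0 wG) //= sqrf_eq0 => /eqP.
Qed.

Lemma poisson (u : V -> R) : exists v c, forall x, Delta v x = u x + c.
Proof.
(* Subtracting the all-ones matrix removes the kernel of Delta: a null vector of [B] has constant
   Laplacian equal to the sum of its entries, so that sum is 0, the vector is constant, and hence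
   zero. *)
pose B : 'M[R]_#|V| := - L - const_mx 1.
have BE v x : fun_of_row (v *m B) x = Delta (fun_of_row v) x - \sum_i v 0 i.
  rewrite mulmxBr mulmxN -!scaleN1r fun_of_row_lin fun_of_row_Lap !mulN1r opprK.
  congr (_ - _); rewrite /fun_of_row mxE.
  by apply: eq_bigr => i _; rewrite mxE mulr1.
have Binj (v : 'rV_#|V|) : v *m B = 0 -> v = 0.
  move=> vB; apply: fun_of_row_inj => x0.
  have DE x : Delta (fun_of_row v) x = \sum_i v 0 i.
    by apply/eqP; rewrite -subr_eq0 -BE vB /fun_of_row mxE.
  have S0 := Lap_const_eq0 wG x0 DE.
  have vC : forall x y, fun_of_row v y = fun_of_row v x.
    by apply: (subharmonic_const wG conn) => x; rewrite DE S0.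
  rewrite [RHS]mxE; apply/eqP; move/eqP: S0.
  under eq_bigr do rewrite -[_ 0 _]/(v 0 _).
  rewrite (eq_bigr (fun=> fun_of_row v x0)) => [|i _]; last first.
    by rewrite (vC (enum_val i) x0) /fun_of_row enum_valK.
  rewrite sumr_const card_ord mulrn_eq0 => /orP[|//].
  by rewrite eqn0Ngt => /negP[]; apply/card_gt0P; exists x0.
have [v vB] := inj_mx_surj Binj (row_of_fun u).
exists (fun_of_row v), (\sum_i v 0 i) => x.
by rewrite -(row_of_funK u) -vB BE subrK.
Qed.

End LaplacianMatrix.

Section DiameterBound.
Variables (R : realFieldType) (V : finType) (w : V -> V -> R) (m : V -> R) (K : R).
Hypothesis wG : weighted_graph w m.
Hypothesis conn : connected w.
Hypothesis K0 : 0 < K.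
Hypothesis CD : CDinf w m K.

Local Notation Delta := (Lap w m).
Local Notation Gamma := (Gam w m).
Local Notation D := (Degmax w m).
Local Notation d := (dist w).
Local Notation L := (negLap_mx w m)^T.

(** Normalized so as to contain all functions that vary by at most 1 along edges. *)
Definition unit_grad (u : V -> R) := forall x, 2%:R * Gamma u u x <= D.

Lemma unit_grad_Lap_le u x : unit_grad u -> Delta u x <= D.
Proof. by move=> uD; apply: (Lap_bound wG (uD x)); apply: Deg_le. Qed.

Lemma unit_grad_Lap_ge u x : unit_grad u -> - D <= Delta u x.
Proof.
move=> uD; have : Delta (fun v => 0 * u v + -1 * u v) x <= D.
  by apply: unit_grad_Lap_le => y; rewrite GamDl !GamDr; have := uD y; lra.
by rewrite LapD; lra.
Qed.

Lemma unit_grad_contract (a c : R) u g : 0 <= a -> a <= 1 ->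
  (forall x, g x = a * u x + (a - 1) / K * Delta u x + c) ->
  unit_grad g -> unit_grad u.
Proof.
move=> a0 a1 gE gD x; have := Gam_contraction wG K0 CD a0 a1 gE (C := D / 2%:R).
move=> H; suff : Gamma u u x <= D / 2%:R by lra.
by apply: H => y; have := gD y; lra.
Qed.

Lemma unit_grad_bound u x y : unit_grad u -> K * (u y - u x) <= 2%:R * D.
Proof.
move=> uD; have [v [c vE]] := poisson wG conn (fun x => - K * u x).
have vD : unit_grad v.
  (* With [a = 0] the contraction is that of the Poisson operator: [u = - Delta v / K + c / K].
     Differences of [u] then become differences of [Delta v], which lies between [-D] and [D]. *)
  apply: (@unit_grad_contract 0 (c / K) v u) uD => // z.
  by rewrite vE; field; exact: lt0r_neq0.
have := unit_grad_Lap_le x vD; have := unit_grad_Lap_ge y vD.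
by rewrite !vE; lra.
Qed.

Lemma dist_unit_grad x0 : unit_grad (fun x => (d x x0)%:R).
Proof.
move=> x; apply: le_trans (Deg_le w m x); rewrite GamffE DegE.
apply: ler_sum => y _; case: (boolP (adj w x y)) => [xy|/(rate_eq0 wG)->]; last first.
  by rewrite mul0r.
rewrite -[leRHS]mulr1 ler_wpM2l ?(rate_ge0 wG) //.
have w0 := w0 wG.
have H1 := dist_adj w0 conn x0 xy.
have yx : adj w y x by rewrite (adjC (wC wG)).
have H2 := dist_adj w0 conn x0 yx.
have [->|[->|->]] : d y x0 = d x x0 \/ d y x0 = (d x x0).+1 \/ d x x0 = (d y x0).+1 by lia.
- by rewrite subrr expr0n.
- by rewrite -natr1; lra.
- by rewrite -natr1; lra.
Qed.

Lemma diam_le x y : K * (d x y)%:R <= 2%:R * D.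
Proof.
have := unit_grad_bound y x (dist_unit_grad y).
by rewrite (distxx conn) subr0.
Qed.

Section Equality.
Variables x0 y0 : V.
Hypothesis dE : K * (d y0 x0)%:R = 2%:R * D.

(** The equality case of [unit_grad_bound]. The increments at [x0] are recorded because they are
    inherited by combinations with coefficient sum 1. *)
Definition extremal u :=
  [/\ unit_grad u, K * (u y0 - u x0) = 2%:R * D & forall y, adj w x0 y -> u y = u x0 + 1].

Lemma dist_extremal : extremal (fun x => (d x x0)%:R).
Proof.
split; first exact: dist_unit_grad; first by rewrite (distxx conn) subr0.
move=> y xy; rewrite (distxx conn) add0r (distC (wC wG) conn).
by move: xy; rewrite -(dist_eq1 (w0 wG) conn) => /eqP->.
Qed.

Lemma extremal_resolvent g : extremal g ->
  exists2 u, extremal u & Deg w m x0 = D /\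
    forall x, g x = 2%:R^-1 * u x - (2%:R * K)^-1 * Delta u x.
Proof.
move=> [gD gE _]; pose B : 'M[R]_#|V| := 2%:R^-1%:M + (2%:R * K)^-1 *: L.
have K2 : 0 < (2%:R * K)^-1 by rewrite invr_gt0 mulr_gt0 ?ltr0n.
have BE v x : fun_of_row (v *m B) x =
    2%:R^-1 * fun_of_row v x - (2%:R * K)^-1 * Delta (fun_of_row v) x.
  by rewrite mulmxDr mul_mx_scalar -scalemxAr fun_of_row_lin fun_of_row_Lap mulrN.
(* A null vector satisfies [Delta f = K f] with [K > 0], so it is nonpositive at its maximum and
   nonnegative at its minimum. *)
have Binj (v : 'rV_#|V|) : v *m B = 0 -> v = 0.
  move=> vB; set f := fun_of_row v.
  have fE x : Delta f x = K * f x.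
    have := BE v x; rewrite vB -/f {1}/fun_of_row mxE => E.
    apply: (mulfI (lt0r_neq0 K2)).
    rewrite [RHS]mulrA (_ : _^-1 * K = 2%:R^-1); last by field; rewrite lt0r_neq0.
    by lra.
  apply: fun_of_row_inj => x; rewrite [RHS]mxE; apply/eqP; rewrite eq_le.
  apply/andP; split.
    have [a aP] := exists_max f x; apply: le_trans (aP x) _.
    by have := Lap_max wG aP; rewrite fE pmulr_rle0.
  have [a aP] := exists_max (fun x => 0 * f x + -1 * f x) x.
  have := Lap_max wG aP; rewrite LapD fE mul0r add0r mulN1r oppr_le0 pmulr_rge0 // => fa.
  by apply: le_trans fa _; rewrite -/f; have := aP x; lra.
have [v vB] := inj_mx_surj Binj (row_of_fun g); set u := fun_of_row v.
have uE x : g x = 2%:R^-1 * u x - (2%:R * K)^-1 * Delta u x.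
  by rewrite -BE vB row_of_funK.
have uD : unit_grad u.
  apply: (@unit_grad_contract 2%:R^-1 0 u g) gD; [lra|lra|].
  by move=> x; rewrite uE; field; rewrite lt0r_neq0.
have Hx := unit_grad_Lap_le x0 uD; have Hy := unit_grad_Lap_ge y0 uD.
have H := unit_grad_bound x0 y0 uD.
have gKE x : 2%:R * K * g x = K * u x - Delta u x.
  by rewrite uE; field; rewrite lt0r_neq0.
(* The total [4 D] splits into [K (u y0 - u x0) <= 2 D], [Delta u x0 <= D] and [- Delta u y0 <= D],
   so all three are equalities; then [Lap_bound_eq] applies at [x0]. *)
have E2 : 2%:R * (2%:R * D) = K * (u y0 - u x0) - (Delta u y0 - Delta u x0).
  by have := gKE x0; have := gKE y0; lra.
have ux : Delta u x0 = D by lra.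
have [Dx u1] := Lap_bound_eq wG (uD x0) (Deg_le w m x0) ux.
by exists u => //; split => //; lra.
Qed.

Lemma extremal_eigenfun : exists f, [/\ eigenfun w m K f,
  forall y, adj w x0 y -> f y = f x0 + 1 & Deg w m x0 = D].
Proof.
pose B : 'M[R]_#|V| := 2%:R^-1%:M + (2%:R * K)^-1 *: L.
have BE v x : fun_of_row (v *m B) x =
    2%:R^-1 * fun_of_row v x + - (2%:R * K)^-1 * Delta (fun_of_row v) x.
  rewrite mulmxDr mul_mx_scalar -scalemxAr fun_of_row_lin fun_of_row_Lap; ring.
have eq_extremal f g : f =1 g -> extremal f -> extremal g.
  move=> fg [H1 H2 H3]; split.
  - by move=> x; rewrite -(eq_Gam w m fg fg).
  - by rewrite -!fg.
  - by move=> y xy; rewrite -!fg H3.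
(* [B] is the inverse of the resolvent. [U] is the distance function after [n] resolvents, so the
   rows [U *m B ^+ i] are the intermediate iterates. *)
have iter_resolvent n : exists U : 'rV_#|V|,
    forall i, (i <= n)%N -> extremal (fun_of_row (U *m B ^+ i)).
  elim: n => [|n [U UE]].
    exists (row_of_fun (fun x => (d x x0)%:R)) => i; rewrite leqn0 => /eqP->.
    rewrite expr0 mulmx1; apply: eq_extremal dist_extremal => x.
    by rewrite row_of_funK.
  have [u uX [_ uE]] := extremal_resolvent (UE 0%N isT).
  have UB : row_of_fun u *m B = U.
    apply: fun_of_row_inj => x; rewrite BE row_of_funK mulNr.
    rewrite (eq_Lap w m (row_of_funK u)) -uE.
    by rewrite expr0 mulmx1.
  exists (row_of_fun u) => -[|i] ni.
    rewrite expr0 mulmx1; apply: eq_extremal uX => x.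
    by rewrite row_of_funK.
  by rewrite exprS -[_ * _]/(_ *m _) mulmxA UB; apply: UE.
have [U UE] := iter_resolvent #|V|.
have [u _ [Dx0 _]] := extremal_resolvent dist_extremal.
have [c [c1]] := cyclic_fixpoint U (semisimple_Lap wG BE).
set v := \sum_(i < _) _ => /= vB; exists (fun_of_row v); split => //.
  move=> x; have := BE v x; rewrite vB => E.
  have K2 : 0 < (2%:R * K)^-1 by rewrite invr_gt0 mulr_gt0 ?ltr0n.
  apply: (mulfI (lt0r_neq0 K2)).
  rewrite mulrN [X in - X]mulrA (_ : _^-1 * K = 2%:R^-1); last by field; rewrite lt0r_neq0.
  by lra.
(* The unit increments at [x0] pass to [v] because the coefficients sum to 1; in particular [v] is
   not a trivial fixed vector. *)
move=> y xy; rewrite !fun_of_row_sum -c1 -big_split; apply: eq_bigr => i _ /=.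
by have [_ _ ->] := UE i (ltn_ord i); rewrite // mulrDr mulr1.
Qed.

End Equality.

Lemma diam_attained : (0 < #|V|)%N -> exists x y, dist w x y = diam w.
Proof.
move=> V0; have [x0 _] := card_gt0P V0.
have [x xE] := @bigop.eq_bigmax _ (fun x => \max_y d x y) V0.
by have [y yE] := @bigop.eq_bigmax _ (d x) V0; exists x, y; rewrite /diam xE yE.
Qed.

Lemma diam_HSS : (1 < #|V|)%N -> (diam w)%:R = 2%:R * D / K ->
  HSS w m (2%:R * D / K) (K / 2%:R).
Proof.
move=> V1 dE; have [y [x dyx]] := diam_attained (ltnW V1).
have E : K * (d y x)%:R = 2%:R * D.
  by rewrite dyx dE mulrC divfK ?lt0r_neq0.
have [f [fE f1 Dx]] := extremal_eigenfun E.
by exists x; apply: eigenfun_HSS fE f1 Dx V1.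
Qed.

(** For the lower bound take [x] farthest from [x0]. By bipartiteness all its neighbours are nearer,
    so [Deg x] is the backward degree, and comparing (i) with (iii) gives [d x x0 = 2D/K]. *)
Lemma HSS_diam : HSS w m (2%:R * D / K) (K / 2%:R) -> (diam w)%:R = 2%:R * D / K.
Proof.
case=> x0 [N0 _ DegD [c cP] dm].
apply/eqP; rewrite eq_le; apply/andP; split.
  have V0 : (0 < #|V|)%N by apply/card_gt0P; exists x0.
  have [y [x <-]] := diam_attained V0.
  by rewrite ler_pdivlMr // mulrC diam_le.
rewrite leNgt; apply/negP => dN.
have diam_ge x : (d x x0 <= diam w)%N.
  apply: leq_trans (@bigop.leq_bigmax _ (fun x => \max_y d x y) x).
  exact: (@bigop.leq_bigmax _ (d x) x0).
have [x xmax] : exists x, forall y, (d y x0 <= d x x0)%N.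
  have [x _ xP] := @arg_maxnP _ x0 xpredT (fun x => d x x0) isT.
  by exists x => y; apply: xP.
have xN : (d x x0)%:R < 2%:R * D / K by apply: le_lt_trans dN; rewrite ler_nat.
have := DegD x.
have -> : Deg w m x = dminus w m x0 x.
  rewrite DegE (dminusE wG); apply: eq_bigr => y _.
  case: (boolP (adj w x y)) => [xy|/(rate_eq0 wG)->]; last by rewrite mul0r.
  suff -> : (d y x0 < d x x0)%N by rewrite mulr1.
  rewrite ltn_neqAle xmax andbT.
  have par := coloring_dist (w0 wG) conn cP x0.
  by have := cP _ _ xy; rewrite (par x) (par y); apply: contraNneq => ->.
rewrite dm [RHS]mulrC => /mulfI -/(_ _) E.
by rewrite E ?ltxx // in xN; rewrite gt_eqF // divr_gt0 ?ltr0n.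
Qed.

End DiameterBound.

(** * Multiplicity of the eigenvalue K *)

Section Multiplicity.
Variables (R : realFieldType) (V : finType) (w : V -> V -> R) (m : V -> R) (K : R).
Hypothesis wG : weighted_graph w m.
Hypothesis conn : connected w.
Hypothesis V1 : (1 < #|V|)%N.
Hypothesis K0 : 0 < K.
Hypothesis CD : CDinf w m K.

Local Notation p := (rate w m).
Local Notation Delta := (Lap w m).
Local Notation Gamma := (Gam w m).
Local Notation D := (Degmax w m).
Local Notation L := (negLap_mx w m)^T.
Local Notation N := (degmax w).

Lemma semisimple_negLap a : semisimple_at L a.
Proof.
apply: (@semisimple_Lap _ _ _ _ wG L 0 (-1)) => v x.
by rewrite fun_of_row_Lap mul0r add0r mulN1r.
Qed.

Lemma eigenspace_eigenfun a v : (v <= eigenspace L a)%MS -> eigenfun w m a (fun_of_row v).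
Proof.
move=> /eigenspaceP vE x; have := fun_of_row_Lap w m v x.
by rewrite vE fun_of_rowZ => ->; rewrite opprK.
Qed.

Lemma eigenfun_const0 a f : 0 < a -> eigenfun w m a f ->
  (forall x y, f y = f x) -> forall x, f x = 0.
Proof.
move=> a0 fE fC x; have := fE x; rewrite LapE big1 => [/esym/eqP|y _].
  by rewrite oppr_eq0 mulf_eq0 gt_eqF //= => /eqP.
by rewrite (fC x y) subrr mulr0.
Qed.

Lemma rank_harmonic : (\rank (eigenspace L 0) <= 1)%N.
Proof.
apply: leq_trans (rank_leq_row (const_mx 1 : 'rV[R]_#|V|)); apply: mxrankS.
apply/row_subP => i; set v := row i _.
have /eigenspace_eigenfun vE : (v <= eigenspace L 0)%MS by apply: row_sub.
have vC : forall x y, fun_of_row v y = fun_of_row v x.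
  by apply: (subharmonic_const wG conn) => x; rewrite vE mul0r oppr0.
have -> : v = fun_of_row v (enum_val i) *: const_mx 1.
  apply/rowP => j; rewrite [RHS]mxE [const_mx _ _ _]mxE mulr1.
  by rewrite (vC (enum_val j)) /fun_of_row enum_valK.
exact: scalemx_sub.
Qed.

Lemma eigen_seq_ge s a : eigen_seq w m s -> a \in s -> a = 0 \/ K <= a.
Proof.
move=> [_ sE] as_.
have : eigenvalue L a.
  rewrite eigenvalue_root_char char_poly_tr sE root_prod_XsubC //.
case/eigenvalueP => v vE v0.
have fE : eigenfun w m a (fun_of_row v).
  by apply: eigenspace_eigenfun; apply/eigenspaceP.
have [x0 _] : exists x : V, true by have /card_gt0P[x _] := ltnW V1; exists x.
case: (lichnerowicz wG conn CD x0 fE) => [f0||]; [|by left|by right].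
by case/eqP: v0; apply: fun_of_row_inj => x; rewrite f0 /fun_of_row mxE.
Qed.

(** The entries with index 0 to [N] are at most [K], hence each is 0 or [K]. As 0 occurs at most
    once, [K] occurs at least [N] times, and semisimplicity turns this count into a dimension. *)
Lemma rank_eigenspace_ge : lambda_eq w m N K -> (N <= \rank (eigenspace L K))%N.
Proof.
case=> s [sS sN]; have [srt sE] := sS.
have mult a : (count_mem a s <= \rank (eigenspace L a))%N.
  by apply: count_le_rank_eigenspace; [exact: semisimple_negLap | rewrite char_poly_tr].
apply: leq_trans (mult K).
(* Beyond the end of [s] the default value 0 would be returned, which is not [K]. *)
have Ns : (N < size s)%N.
  by rewrite ltnNge; apply/negP => /(nth_default 0); rewrite sN => E; move: K0; rewrite E ltxx.
have c0 : (count_mem 0%R s <= 1)%N by apply: leq_trans (mult 0) rank_harmonic.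
have tE : all (fun a => (a == 0) || (a == K)) (take N.+1 s).
  apply/(all_nthP 0) => i; rewrite size_takel // => iN; rewrite nth_take //.
  have iK : s`_i <= K.
    rewrite -sN; apply: (sorted_leq_nth le_trans le_refl) => //; rewrite ?inE //.
    exact: leq_trans iN Ns.
  have [->|Ki] := eigen_seq_ge sS (mem_nth 0 (leq_trans iN Ns)); first by rewrite eqxx.
  by rewrite (eq_le s`_i K) iK Ki orbT.
have : (N.+1 <= count_mem 0%R (take N.+1 s) + count_mem K (take N.+1 s))%N.
  rewrite -count_predUI -[leqLHS](size_takel Ns).
  move: tE; rewrite all_count => /eqP <-; exact: leq_addr.
have H b : (count_mem b (take N.+1 s) <= count_mem b s)%N.
  by rewrite -[in leqRHS](cat_take_drop N.+1 s) count_cat leq_addr.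
by move=> /leq_trans/(_ (leq_add (leq_trans (H 0) c0) (H K))); rewrite add1n ltnS.
Qed.

Lemma deg_le x : (deg w x <= N)%N.
Proof. exact: (@bigop.leq_bigmax _ (deg w) x). Qed.

(** [G] takes the gradient at [x]. An eigenfunction with zero gradient there has [Gamma = 0]
    everywhere, hence is constant and zero. So [N <= rank E = rank (E G) <= deg x <= N], and every
    gradient is attained. *)
Lemma eigenfun_gradient x (t : V -> R) : lambda_eq w m N K ->
  deg w x = N /\ exists2 f, eigenfun w m K f & forall y, adj w x y -> f y - f x = t y.
Proof.
move=> /rank_eigenspace_ge rN; pose A := [set y | adj w x y].
pose G : 'M[R]_(#|V|, #|A|) :=
  \matrix_(i, k) ((enum_val i == enum_val k)%:R - (enum_val i == x)%:R).
have sum_delta (v : 'rV[R]_#|V|) y :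
    \sum_i v 0 i * (enum_val i == y)%:R = fun_of_row v y.
  rewrite (bigD1 (enum_rank y)) //= enum_rankK eqxx mulr1 big1 ?addr0 // => i iy.
  case: eqP => [E|_]; last by rewrite mulr0.
  by rewrite -E enum_valK eqxx in iy.
have GE (v : 'rV_#|V|) k : (v *m G) 0 k = fun_of_row v (enum_val k) - fun_of_row v x.
  rewrite mxE; under eq_bigr do rewrite mxE mulrBr.
  by rewrite sumrB !sum_delta.
set E := eigenspace L K.
have cap0 : (E :&: kermx G)%MS = 0.
  apply/eqP/rowV0P => v; rewrite sub_capmx => /andP[vE /sub_kermxP vG].
  have fE := eigenspace_eigenfun vE.
  have G0 : Gamma (fun_of_row v) (fun_of_row v) x = 0.
    rewrite GamE (eq_rate_sum wG (G := fun=> 0)).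
      by rewrite big1 ?mul0r // => y _; rewrite mulr0.
    move=> y xy; have yA : y \in A by rewrite inE.
    have := GE v (enum_rank_in yA y); rewrite enum_rankK_in // vG mxE => <-.
    by rewrite mul0r.
  have fC := Gam0_const wG conn (fun y => etrans (eigen_Gam_const wG conn CD fE x y) G0).
  by apply: fun_of_row_inj => y; rewrite (eigenfun_const0 K0 fE fC) /fun_of_row mxE.
have rEG : \rank (E *m G) = \rank E.
  by have := mxrank_mul_ker E G; rewrite cap0 mxrank0 addn0.
have dA : deg w x = #|A| by [].
have := rank_leq_col (E *m G); rewrite rEG -dA => H.
have degN : deg w x = N.
  by apply/eqP; rewrite eqn_leq deg_le (leq_trans rN).
split=> //.
have fullEG : row_full (E *m G).
  by rewrite /row_full rEG eqn_leq H /= -dA degN.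
have /submxP[u uE] : (\row_k t (enum_val k) <= E *m G)%MS by apply: submx_full.
exists (fun_of_row (u *m E)).
  by apply: eigenspace_eigenfun; apply: submxMl.
move=> y xy; have yA : y \in A by rewrite inE.
have := GE (u *m E) (enum_rank_in yA y).
by rewrite -mulmxA -uE mxE enum_rankK_in // => <-.
Qed.

(** Prescribe increment 1 towards [y] and 0 along the other edges at [x]. Then [2 Gamma f] is
    [p x y] at [x] and at least [p y x] at [y], and it is constant. In case of equality [f] has no
    other increment at [y], and subtracting the eigenvalue equations at [x] and [y] gives
    [2 p x y = K]. *)
Lemma lambda_rate_le x y : lambda_eq w m N K -> adj w x y -> p y x <= p x y /\
  (p y x = p x y -> p x y = K / 2%:R).
Proof.
move=> lK xy; have [_ [f fE fx]] := eigenfun_gradient x (fun z => (z == y)%:R) lK.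
have yx : adj w y x by rewrite (adjC (wC wG)).
have fyx : f y = f x + 1 by have := fx y xy; rewrite eqxx mulr1n; lra.
have Gx : 2%:R * Gamma f f x = p x y.
  rewrite GamffE (eq_rate_sum wG (G := fun z => (z == y)%:R)) => [|z xz].
    rewrite (bigD1 y) //= big1 ?eqxx ?mulr1 ?addr0 // => z /negPf->.
    by rewrite mulr0.
  by rewrite fx //; case: eqP; rewrite ?expr1n ?expr0n.
have Gy : 2%:R * Gamma f f y = p y x + \sum_(z | z != x) p y z * (f z - f y) ^+ 2.
  rewrite GamffE (bigD1 x) //= fyx; congr (_ + _).
  by rewrite opprD addNKr sqrrN expr1n mulr1.
have term0 z : 0 <= p y z * (f z - f y) ^+ 2.
  by rewrite mulr_ge0 ?sqr_ge0 ?(rate_ge0 wG).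
rewrite -Gx -(eigen_Gam_const wG conn CD fE x y) Gy; split.
  by rewrite lerDl sumr_ge0.
move=> E.
have /eqP : \sum_(z | z != x) p y z * (f z - f y) ^+ 2 = 0 by lra.
rewrite psumr_eq0 // => /allP S0.
have zterm z : z != x -> p y z * (f z - f y) = 0.
  move=> zx; have := S0 z; rewrite mem_index_enum zx => /(_ isT) /=.
  by rewrite mulf_eq0 sqrf_eq0 -mulf_eq0 => /eqP.
have Ly : Delta f y = - p y x.
  rewrite LapE (bigD1 x) //= big1 => [|z /zterm //].
  by rewrite fyx; ring.
have Lx : Delta f x = p x y.
  rewrite LapE (eq_rate_sum wG (G := fun z => (z == y)%:R)) => [|z /fx //].
  rewrite (bigD1 y) //= big1 ?eqxx ?mulr1 ?addr0 // => z /negPf->.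
  by rewrite mulr0.
have pxy : p y x = p x y by rewrite -Gx -(eigen_Gam_const wG conn CD fE x y) Gy.
rewrite -E pxy.
have := fE x; have := fE y; rewrite Ly Lx fyx pxy; lra.
Qed.

Lemma lambda_rate x y : lambda_eq w m N K -> adj w x y -> p x y = K / 2%:R.
Proof.
move=> lK xy; have yx : adj w y x by rewrite (adjC (wC wG)).
have [le1 H] := lambda_rate_le lK xy; have [le2 _] := lambda_rate_le lK yx.
by apply/H/eqP; rewrite eq_le le1 le2.
Qed.

Lemma lambda_const_edge_deg : lambda_eq w m N K -> const_edge_deg w m (K / 2%:R).
Proof.
move=> lK x y; case: (boolP (adj w x y)) => [/(lambda_rate lK)|/(rate_eq0 wG)] E.
  by right; rewrite -E.
by left; rewrite -E.
Qed.

Lemma lambda_HSS : lambda_eq w m N K -> HSS w m (2%:R * D / K) (K / 2%:R).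
Proof.
move=> lK.
have DegE' x : Deg w m x = (K / 2%:R) * N%:R.
  rewrite DegE -(eigenfun_gradient x (fun=> 0) lK).1.
  rewrite /deg -sum1_card natr_sum mulr_sumr [RHS]big_mkcond.
  apply: eq_bigr => y _; rewrite inE.
  by case: (boolP (adj w x y)) => [/(lambda_rate lK)->|/(rate_eq0 wG)->]; rewrite ?mulr1.
have DE : D = (K / 2%:R) * N%:R.
  have [x _] : exists x : V, true by have /card_gt0P[x _] := ltnW V1; exists x.
  apply/eqP; rewrite eq_le -{2}(DegE' x) Deg_le andbT.
  rewrite /Degmax; elim/big_ind: _ => [|a b Ha Hb|y _].
  - by rewrite mulr_ge0 ?divr_ge0 ?ler0n // ltW.
  - by rewrite ge_max Ha Hb.
  - by rewrite DegE'.
have [x0 _] : exists x : V, true by have /card_gt0P[x _] := ltnW V1; exists x.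
have [_ [f fE fx]] := eigenfun_gradient x0 (fun=> 1) lK.
exists x0; apply: (eigenfun_HSS wG conn K0 CD fE) => //; last by rewrite DegE' DE.
by move=> y /fx; lra.
Qed.

End Multiplicity.

(** * Local curvature of bipartite regular graphs *)

Section Unweighted.
Variables (R : realFieldType) (V : finType) (w : V -> V -> R).

Lemma adj_unw x y : adj (unw w) x y = adj w x y.
Proof. by rewrite /adj /unw; case: ifP; rewrite ?ltr01 ?ltxx. Qed.

Lemma walkn_unw n x y : walkn (unw w) n x y = walkn w n x y.
Proof. by elim: n x => //= n IHn x; apply: eq_existsb => z; rewrite adj_unw IHn. Qed.

Lemma dist_unw x y : dist (unw w) x y = dist w x y.
Proof. by apply: eq_find => n; rewrite walkn_unw. Qed.

Lemma sphere_unw k x : sphere (unw w) k x = sphere w k x.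
Proof. by apply/setP => y; rewrite !inE dist_unw. Qed.

Lemma deg_unw x : deg (unw w) x = deg w x.
Proof. by congr #|pred_of_set _|; apply/setP => y; rewrite !inE adj_unw. Qed.

Lemma unwE x y : unw w x y = (adj w x y)%:R.
Proof. by rewrite /unw /adj; case: ifP. Qed.

Lemma Deg_unw x : Deg (unw w) (@one_m R V) x = (deg w x)%:R.
Proof.
rewrite /Deg invr1 mul1r /deg -sum1_card natr_sum [RHS]big_mkcond /=.
by apply: eq_bigr => y _; rewrite unwE inE; case: ifP.
Qed.

Lemma dminus_unw x0 z :
  dminus (unw w) (@one_m R V) x0 z =
  #|[set y | adj w y z && (dist w y x0 < dist w z x0)%N]|%:R.
Proof.
rewrite /dminus -sum1_card natr_sum; apply: eq_big => [y|y].
  by rewrite inE adj_unw !dist_unw.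
by rewrite adj_unw unwE => /andP[-> _]; rewrite divr1.
Qed.

End Unweighted.

Section Bipartite.
Variables (R : realFieldType) (V : finType) (w : V -> V -> R) (m : V -> R).
Hypothesis wG : weighted_graph w m.
Hypothesis conn : connected w.
Hypothesis bip : bipartite w.
Local Notation a x y := ((adj w x y)%:R : R).
Local Notation d := (dist w).

Definition common x z := #|[set y | adj w x y && adj w y z]|.

Lemma commonE x z : (common x z)%:R = \sum_y a x y * a y z.
Proof.
rewrite /common -sum1_card natr_sum big_mkcond; apply: eq_bigr => y _.
by rewrite inE -natrM mulnb; case: ifP.
Qed.

Lemma degE x : (deg w x)%:R = \sum_y a x y.
Proof.
rewrite /deg -sum1_card natr_sum big_mkcond; apply: eq_bigr => y _.
by rewrite inE; case: ifP.
Qed.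

Lemma no_triangle x y z : adj w x y -> adj w y z -> adj w x z = false.
Proof.
case: bip => c cP xy yz; apply/negP => xz.
by have := cP _ _ xy; have := cP _ _ yz; have := cP _ _ xz; case: (c x) (c y) (c z) => [] [] [].
Qed.

Lemma dist2P x z : reflect (x != z /\ exists2 y, adj w x y & adj w y z) (d x z == 2%N).
Proof.
apply: (iffP eqP) => [xz2|[xz [y xy yz]]].
  split; first by rewrite -(dist_eq0 conn) xz2.
  have [y xy yz1] := dist_pred (w0 wG) conn xz2.
  by exists y => //; rewrite -(dist_eq1 (w0 wG) conn) yz1.
apply/eqP; rewrite eqn_leq; apply/andP; split.
  by apply: (dist_le conn); apply: (@walkn_cat _ _ _ 1 1 _ y); rewrite walkn1.
have := no_triangle xy yz; rewrite -(dist_eq1 (w0 wG) conn).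
by move: xz; rewrite -(dist_eq0 conn); lia.
Qed.

Lemma sphere2E x z : (z \in sphere w 2 x) = (x != z) && (0 < common x z)%N.
Proof.
rewrite inE; apply/dist2P/andP => [[xz [y xy yz]]|[xz]].
  by split=> //; apply/card_gt0P; exists y; rewrite inE xy.
by case/card_gt0P=> y; rewrite inE => /andP[xy yz]; split=> //; exists y.
Qed.

Lemma common_adj x y : adj w x y -> common x y = 0%N.
Proof.
move=> xy; apply/eqP; rewrite cards_eq0; apply/eqP/setP => z; rewrite !inE.
by apply/negP => /andP[xz zy]; rewrite (no_triangle xz zy) in xy.
Qed.

End Bipartite.

Lemma const_edge_rate (R : realFieldType) (V : finType) (w : V -> V -> R) (m : V -> R) k :
  weighted_graph w m -> 0 < k -> const_edge_deg w m k ->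
  forall x y, rate w m x y = k * (adj w x y)%:R.
Proof.
move=> wG k0 cE x y; rewrite -(rate_gt0 wG) /rate.
by case: (cE x y) => ->; rewrite ?ltxx ?mulr0 // k0 mulr1.
Qed.

Section LocalCurvature.
Variables (R : realFieldType) (V : finType) (w : V -> V -> R) (m : V -> R) (K : R) (n : nat).
Hypothesis wG : weighted_graph w m.
Hypothesis conn : connected w.
Hypothesis bip : bipartite w.
Hypothesis K0 : 0 < K.
Hypothesis CD : CDinf w m K.
Hypothesis rateE : forall x y, rate w m x y = K / 2%:R * (adj w x y)%:R.
Hypothesis degn : forall x, deg w x = n.
Local Notation a x y := ((adj w x y)%:R : R).
Local Notation N := (n%:R : R).

(** The right side is [2 (Gamma2 h - K Gamma h) / k ^+ 2] at [x], with [k = K / 2]. Numbers of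
    common neighbours enter when the double sum over two-step paths is ordered by endpoint. *)
Lemma local_CD x (h : V -> R) : h x = 0 ->
  0 <= 2%:R^-1 * \sum_z (common w x z)%:R * h z ^+ 2
     - 2%:R * \sum_z h z * (\sum_y a x y * a y z * h y)
     + (N - 2%:R) * \sum_y a x y * h y ^+ 2 + (\sum_y a x y * h y) ^+ 2.
Proof.
move=> hx; pose k := K / 2%:R.
have k0 : 0 < k by rewrite divr_gt0 ?ltr0n.
have DE y : Lap w m h y = k * \sum_z a y z * (h z - h y).
  by rewrite LapE mulr_sumr; apply: eq_bigr => z _; rewrite rateE mulrA.
have GE y : Gam w m h h y = k / 2%:R * \sum_z a y z * (h z - h y) ^+ 2.
  rewrite GamE [RHS]mulrAC mulr_sumr; congr (_ / _); apply: eq_bigr => z _.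
  by rewrite rateE -/k; ring.
have Na y : \sum_z a y z = N by rewrite -degE degn.
set A := \sum_y a x y * h y ^+ 2; set S := \sum_y a x y * h y.
have Gx : Gam w m h h x = k / 2%:R * A.
  by rewrite GE; congr (_ * _); apply: eq_bigr => y _; rewrite hx subr0.
have Dx : Lap w m h x = k * S.
  by rewrite DE; congr (_ * _); apply: eq_bigr => y _; rewrite hx subr0.
have T1 : Lap w m (Gam w m h h) x =
   k ^+ 2 / 2%:R * (\sum_y a x y * (\sum_z a y z * (h z - h y) ^+ 2) - N * A).
  rewrite LapE -(Na x) mulr_suml -sumrB mulr_sumr; apply: eq_bigr => y _.
  by rewrite rateE Gx GE -/k; field.
have T2 : Gam w m h (Lap w m h) x =
   k ^+ 2 / 2%:R * (\sum_y a x y * (h y * \sum_z a y z * (h z - h y)) - S ^+ 2).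
  have -> : S ^+ 2 = \sum_y a x y * h y * S by rewrite expr2 {1}/S mulr_suml.
  rewrite GamE -sumrB [RHS]mulrAC mulr_sumr; congr (_ / _).
  by apply: eq_bigr => y _; rewrite rateE hx Dx DE -/k; ring.
have T3 : \sum_y a x y * (\sum_z a y z * (h z - h y) ^+ 2)
   - 2%:R * \sum_y a x y * (h y * \sum_z a y z * (h z - h y)) =
   \sum_z (common w x z)%:R * h z ^+ 2
   - 2%:R * 2%:R * \sum_z h z * (\sum_y a x y * a y z * h y) + 3%:R * N * A.
  have -> : \sum_z (common w x z)%:R * h z ^+ 2 = \sum_y \sum_z a x y * a y z * h z ^+ 2.
    by rewrite exchange_big; apply: eq_bigr => z _; rewrite commonE mulr_suml.
  have -> : \sum_z h z * (\sum_y a x y * a y z * h y) = \sum_y \sum_z a x y * a y z * h y * h z.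
    rewrite exchange_big; apply: eq_bigr => z _ /=; rewrite mulrC mulr_suml.
    by apply: eq_bigr.
  rewrite /A !mulr_sumr -!sumrB -big_split; apply: eq_bigr => y _ /=.
  rewrite -(Na y) !mulr_sumr !mulr_suml -!sumrB -big_split.
  by apply: eq_bigr => z _ /=; ring.
have := CD h x; rewrite /Gam2 T1 T2 Gx -subr_ge0.
set X := \sum_y a x y * (\sum_z a y z * (h z - h y) ^+ 2) in T1 T3 *.
set Y := \sum_y a x y * (h y * \sum_z a y z * (h z - h y)) in T2 T3 *.
have -> : K = 2%:R * k by rewrite /k; field.
rewrite (_ : _ - _ = k ^+ 2 * (2%:R^-1 *
    (2%:R^-1 * (X - 2%:R * Y) - N * A / 2%:R + S ^+ 2 - 2%:R * A))).
  rewrite pmulr_rge0 ?exprn_gt0 // pmulr_rge0 ?invr_gt0 ?ltr0n // T3 => H.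
  by lra.
by field.
Qed.

Lemma sum_delta_adj x y (F : V -> R) : adj w x y ->
  \sum_v a x v * ((v == y)%:R * F v) = F y.
Proof.
move=> xy; rewrite (bigD1 y) //= xy eqxx !mul1r big1 ?addr0 // => v /negPf->.
by rewrite mul0r mulr0.
Qed.

Lemma sum_adj_sphere2 x y : adj w x y -> \sum_(z in sphere w 2 x) a y z = N - 1.
Proof.
move=> xy; have yx : adj w y x by rewrite (adjC (wC wG)).
rewrite -(degn y) degE [in RHS](bigD1 x) //= yx addrAC subrr add0r big_mkcond [RHS]big_mkcond.
apply: eq_bigr => z _ /=; rewrite (sphere2E wG) // eq_sym.
have [->|zx] := eqVneq z x => //=; case: ifP => // /negbT; rewrite -leqNgt leqn0.
rewrite cards_eq0 => /eqP/setP/(_ y); rewrite !inE xy /= => ->.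
by [].
Qed.

Lemma curvature_SSP x : SSP w x.
Proof.
have key y0 : adj w x y0 ->
    \sum_(z in sphere w 2 x) a y0 z / (common w x z)%:R <= (N - 1) / 2%:R.
  move=> xy0.
  have y0x : y0 != x by apply: contraTneq xy0 => ->; rewrite (adjxx (w0 wG)).
  (* With [h] fixed on the first sphere as the indicator of [y0], the value at [z] minimizes
     [c / 2 * t ^+ 2 - 2 * a y0 z * t], where [c = common w x z]. *)
  pose h v : R := if v \in sphere w 2 x then 2%:R * a y0 v / (common w x v)%:R
                  else (v == y0)%:R.
  have h1 v : adj w x v -> h v = (v == y0)%:R.
    move=> xv; rewrite /h (sphere2E wG) //.
    by rewrite (common_adj bip xv) andbF.
  have hx : h x = 0.
    by rewrite /h (sphere2E wG) // eqxx /= eq_sym (negPf y0x).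
  have H := local_CD hx.
  have U z : \sum_y a x y * a y z * h y = a y0 z.
    rewrite -[RHS](sum_delta_adj (fun y => a y z) xy0); apply: eq_bigr => y _.
    by case: (boolP (adj w x y)) => [/h1->|_]; rewrite /=; ring.
  have E1 : \sum_y a x y * h y = 1.
    rewrite -[RHS](sum_delta_adj (fun=> 1) xy0); apply: eq_bigr => y _.
    by case: (boolP (adj w x y)) => [/h1->|_]; rewrite /=; ring.
  have E2 : \sum_y a x y * h y ^+ 2 = 1.
    rewrite -[RHS]E1; apply: eq_bigr => y _.
    case: (boolP (adj w x y)) => [/h1->|_]; rewrite ?mul0r //.
    by case: eqP => _; rewrite /=; ring.
  move: H; rewrite E1 E2 !mulr_sumr -sumrB.
  rewrite (_ : \sum_z _ = - 2%:R * \sum_(z in sphere w 2 x) a y0 z / (common w x z)%:R).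
    by lra.
  rewrite mulr_sumr big_mkcond [RHS]big_mkcond; apply: eq_bigr => z _ /=.
  rewrite U; case: ifP => zS.
    rewrite /h zS; have : (common w x z)%:R != 0 :> R.
      by rewrite pnatr_eq0 -lt0n; move: zS; rewrite (sphere2E wG) // => /andP[].
    by move=> c0; case: (adj w y0 z); rewrite /=; field.
  rewrite /h zS; have [->|_] := eqVneq z y0; last by rewrite /=; ring.
  by rewrite (common_adj bip xy0) (adjxx (w0 wG)) /=; ring.
(* Summed over all neighbours of [x], the left side counts each [z] with total weight [c / c = 1],
   giving the size of the second sphere. *)
have : \sum_y a x y * \sum_(z in sphere w 2 x) a y z / (common w x z)%:R
    <= \sum_y a x y * ((N - 1) / 2%:R).
  apply: ler_sum => y _; case: (boolP (adj w x y)) => [/key|_]; last by rewrite !mul0r.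
  by rewrite !mul1r.
rewrite -mulr_suml -degE degn.
under eq_bigr do rewrite mulr_sumr; rewrite exchange_big /=.
rewrite (eq_bigr (fun=> 1)) => [|z]; last first.
  rewrite (sphere2E wG) // => /andP[_ c0]; under eq_bigr do rewrite mulrA.
  by rewrite -mulr_suml -commonE divff // pnatr_eq0 -lt0n.
rewrite sumr_const => H; rewrite /SSP degn bin2 -divn2 leq_divRL //.
rewrite -(ler_nat R) !natrM.
case: n H => [|n'] H; first by move: H; rewrite !mul0r; lra.
by move: H; rewrite -natr1 /=; lra.
Qed.

Lemma curvature_NCP x y1 y2 : (forall z, z \in sphere w 2 x -> common w x z = 2%N) ->
  adj w x y1 -> adj w x y2 -> y1 != y2 ->
  (#|[set z in sphere w 2 x | adj w y1 z && adj w z y2]| <= 1)%N.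
Proof.
move=> c2 xy1 xy2 y12.
(* Again the minimizing choice on the second sphere, now for two indicators and [c = 2]. It yields
   [2 N] as a bound for the sum of [(a y1 z + a y2 z) ^+ 2]. *)
pose h v : R := if v \in sphere w 2 x then a y1 v + a y2 v
                else (v == y1)%:R + (v == y2)%:R.
have h1 v : adj w x v -> h v = (v == y1)%:R + (v == y2)%:R.
  by move=> xv; rewrite /h (sphere2E wG) // (common_adj bip xv) andbF.
have nx y : adj w x y -> (x == y) = false.
  by move=> xy; apply: contraTF xy => /eqP<-; rewrite (adjxx (w0 wG)).
have hx : h x = 0 by rewrite /h (sphere2E wG) // eqxx /= !nx // addr0.
have H := local_CD hx.
have split_sum (F : V -> R) : \sum_y a x y * (h y * F y) = F y1 + F y2.
  rewrite -(sum_delta_adj F xy1) -(sum_delta_adj F xy2) -big_split.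
  apply: eq_bigr => y _ /=.
  by case: (boolP (adj w x y)) => [/h1->|_]; rewrite /=; ring.
have U z : \sum_y a x y * a y z * h y = a y1 z + a y2 z.
  by rewrite -(split_sum (fun y => a y z)); apply: eq_bigr => y _; rewrite -mulrA [h y * _]mulrC.
have E1 : \sum_y a x y * h y = 2%:R.
  transitivity (\sum_y a x y * (h y * 1)); last by rewrite split_sum.
  by apply: eq_bigr => y _; rewrite mulr1.
have E2 : \sum_y a x y * h y ^+ 2 = 2%:R.
  rewrite [LHS](split_sum h) !h1 // !eqxx [y2 == y1]eq_sym (negPf y12) /=.
  by rewrite addr0 add0r.
move: H; rewrite E1 E2 !mulr_sumr -sumrB.
rewrite (_ : \sum_z _ = - \sum_(z in sphere w 2 x) (a y1 z + a y2 z) ^+ 2); last first.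
  rewrite -sumrN [RHS]big_mkcond; apply: eq_bigr => z _ /=.
  rewrite U; case: ifP => zS; first by rewrite /h zS c2 //=; field.
  rewrite /h zS; have [->|_] := eqVneq z y1.
    rewrite (common_adj bip xy1) (adjxx (w0 wG)) [adj w y2 y1](_ : _ = false).
      by rewrite /=; ring.
    by rewrite (adjC (wC wG)); apply: (no_triangle bip (y := x)); rewrite // (adjC (wC wG)).
  have [->|_] := eqVneq z y2; last by rewrite /=; ring.
  rewrite (common_adj bip xy2) (adjxx (w0 wG)) [adj w y1 y2](_ : _ = false).
    by rewrite /=; ring.
  by apply: (no_triangle bip (y := x)); rewrite // (adjC (wC wG)).
(* The two diagonal parts amount to [2 (N - 1)], which leaves at most 2 for twice the number of [z]
   adjacent to both. *)
rewrite (_ : \sum_(z in _) _ = \sum_(z in sphere w 2 x) a y1 z + \sum_(z in sphere w 2 x) a y2 z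
  + 2%:R * \sum_(z in sphere w 2 x) (adj w y1 z && adj w z y2)%:R); last first.
  rewrite mulr_sumr -!big_split; apply: eq_bigr => z _ /=.
  by rewrite [adj w z y2](adjC (wC wG)); case: (adj w y1 z) (adj w y2 z) => [] []; rewrite /=; ring.
rewrite !sum_adj_sphere2 // -natr_sum => H.
rewrite -(ler_nat R) -sum1_card.
rewrite (_ : \sum_(i in _) 1 = \sum_(z in sphere w 2 x) (adj w y1 z && adj w z y2))%N.
  by lra.
rewrite [LHS]big_mkcond [RHS]big_mkcond; apply: eq_bigr => z _ /=.
by rewrite !inE; case: eqP => //=; case: ifP.
Qed.

End LocalCurvature.

(** * Reconstruction of the hypercube from its shells *)

Section Counting.
Local Open Scope nat_scope.
Variable T : finType.

(** Double counting of an element [b] together with an ordered pair of distinct [a], [a'] related to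
    it. *)
Lemma sum_card_pairs (A B : {set T}) (r : rel T) :
  \sum_(b in B) #|[set a in A | r a b]| * (#|[set a in A | r a b]|).-1 =
  \sum_(a in A) \sum_(a' in A :\ a) #|[set b in B | r a b && r a' b]|.
Proof.
transitivity (\sum_(b in B) \sum_(a in A) \sum_(a' in A :\ a) (r a b && r a' b)).
  apply: eq_bigr => b _; set C := [set a in A | r a b].
  have -> : #|C| * #|C|.-1 = \sum_(a in C) #|C :\ a|.
    rewrite (eq_bigr (fun=> #|C|.-1)) ?sum_nat_const // => a aC.
    by rewrite [in RHS](cardsD1 a) aC.
  rewrite [LHS]big_mkcond [RHS]big_mkcond; apply: eq_bigr => a _ /=.
  rewrite inE; case: (a \in A) => //=; case: (r a b) => /=; last by rewrite big1.
  rewrite -sum1_card [LHS]big_mkcond [RHS]big_mkcond; apply: eq_bigr => a' _ /=.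
  by rewrite !inE; case: (a' != a) (a' \in A) (r a' b) => [] [] [].
rewrite exchange_big; apply: eq_bigr => a _ /=.
rewrite exchange_big; apply: eq_bigr => a' _ /=.
rewrite -sum1_card [LHS]big_mkcond [RHS]big_mkcond; apply: eq_bigr => b _ /=.
by rewrite !inE; case: (b \in B) (r a b) (r a' b) => [] [] [].
Qed.

Lemma sum_card_incidence (A B : {set T}) (r : rel T) :
  \sum_(b in B) #|[set a in A | r a b]| = \sum_(a in A) #|[set b in B | r a b]|.
Proof.
transitivity (\sum_(b in B) \sum_(a in A) r a b); last first.
  rewrite exchange_big; apply: eq_bigr => a _ /=.
  rewrite -sum1_card [LHS]big_mkcond [RHS]big_mkcond; apply: eq_bigr => b _ /=.
  by rewrite !inE; case: (b \in B) (r a b) => [] [].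
apply: eq_bigr => b _; rewrite -sum1_card [LHS]big_mkcond [RHS]big_mkcond.
by apply: eq_bigr => a _ /=; rewrite !inE; case: (a \in A) (r a b) => [] [].
Qed.

Lemma sum_pairs_const (A : {set T}) :
  \sum_(a in A) \sum_(a' in A :\ a) 1 = #|A| * #|A|.-1.
Proof.
rewrite (eq_bigr (fun=> #|A|.-1)) ?sum_nat_const // => a aA.
by rewrite sum1_card [in RHS](cardsD1 a) aA.
Qed.

Lemma sum_leq_eq (P : pred T) (F G : T -> nat) :
  (forall i, P i -> F i <= G i) -> \sum_(i | P i) G i <= \sum_(i | P i) F i ->
  forall i, P i -> F i = G i.
Proof.
move=> FG le i Pi; apply/eqP; rewrite eqn_leq FG //=.
rewrite -(leq_add2r (\sum_(j | P j && (j != i)) F j)).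
have E H : \sum_(j | P j) H j = H i + \sum_(j | P j && (j != i)) H j by exact: bigD1.
move: le; rewrite (E F) => /(leq_trans _); apply; rewrite (E G) leq_add2l.
by apply: leq_sum => j /andP[Pj _]; apply: FG.
Qed.

Lemma sum_pairs_eq1 (A : {set T}) (F : T -> T -> nat) :
  (forall a a', a \in A -> a' \in A -> a' != a -> F a a' <= 1) ->
  #|A| * #|A|.-1 <= \sum_(a in A) \sum_(a' in A :\ a) F a a' ->
  forall a a', a \in A -> a' \in A -> a' != a -> F a a' = 1.
Proof.
move=> F1; rewrite -sum_pairs_const => le a a' aA a'A ne.
have inner b : b \in A -> \sum_(b' in A :\ b) F b b' <= \sum_(b' in A :\ b) 1.
  by move=> bA; apply: leq_sum => b'; rewrite !inE => /andP[? ?]; apply: F1.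
have := sum_leq_eq inner le aA => E.
apply: (@sum_leq_eq (mem (A :\ a)) (F a) (fun=> 1)); last by rewrite !inE ne.
  by move=> b'; rewrite !inE => /andP[? ?]; apply: F1.
by rewrite E.
Qed.

End Counting.

Section Shells.
Local Open Scope nat_scope.
Variables (R : realFieldType) (V : finType) (w : V -> V -> R) (m : V -> R) (x0 : V) (n : nat).
Hypothesis wG : weighted_graph w m.
Hypothesis conn : connected w.
Hypothesis bip : bipartite w.
Hypothesis degn : forall x, deg w x = n.
Local Notation d := (dist w).
Local Notation lv z := (dist w z x0).
Hypothesis lowE : forall z, #|[set y | adj w y z && (lv y < lv z)]| = lv z.
Hypothesis ssp : forall x, SSP w x.
Hypothesis ncp : forall x, (forall z, z \in sphere w 2 x -> common w x z = 2) ->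
  forall y1 y2, adj w x y1 -> adj w x y2 -> y1 != y2 ->
  #|[set z in sphere w 2 x | adj w y1 z && adj w z y2]| <= 1.

Let wC := wC wG.
Let w0 := w0 wG.
Local Notation adjC := (adjC wC).

Definition lower z := [set y | adj w y z && (lv y < lv z)].
Definition upper z := [set y | adj w y z && (lv z < lv y)].

Lemma level_adj x y : adj w x y -> lv x = (lv y).+1 \/ lv y = (lv x).+1.
Proof.
move=> xy; have yx : adj w y x by rewrite adjC.
have H1 := dist_adj w0 conn x0 xy; have H2 := dist_adj w0 conn x0 yx.
suff : lv x != lv y by lia.
case: bip => c cP; have par := coloring_dist w0 conn cP x0.
by have := cP _ _ xy; rewrite (par x) (par y); apply: contraNneq => ->.
Qed.

Lemma in_lower y z : (y \in lower z) = adj w y z && (lv z == (lv y).+1).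
Proof.
rewrite inE; case: (boolP (adj w y z)) => //= /level_adj[]->; lia.
Qed.

Lemma in_upper y z : (y \in upper z) = adj w y z && (lv y == (lv z).+1).
Proof.
rewrite inE; case: (boolP (adj w y z)) => //= /level_adj[]->; lia.
Qed.

Lemma upper_lower y z : (y \in upper z) = (z \in lower y).
Proof. by rewrite in_upper in_lower adjC. Qed.

Lemma card_lower z : #|lower z| = lv z.
Proof. exact: lowE. Qed.

Lemma nbrE z : [set y | adj w z y] = lower z :|: upper z.
Proof.
apply/setP => y; rewrite !inE [adj w y z]adjC; case: (boolP (adj w z y)) => //=.
by move/level_adj=> [] ->; lia.
Qed.

Lemma lower_upper_disj z : lower z :&: upper z = set0.
Proof. by apply/setP => y; rewrite !inE; case: (adj w y z) => //=; lia. Qed.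

Lemma card_upper z : #|upper z| = n - lv z.
Proof.
have := cardsUI (lower z) (upper z); rewrite lower_upper_disj cards0 addn0 -nbrE.
by rewrite -/(deg w z) degn card_lower => ->; rewrite addKn.
Qed.

Lemma commonC x z : common w x z = common w z x.
Proof.
rewrite /common; apply: eq_card => y.
by rewrite !inE [adj w x y]adjC [adj w y z]adjC andbC.
Qed.

Lemma common_level x z : 0 < common w x z ->
  [\/ lv z = (lv x).+2, lv z = lv x | lv x = (lv z).+2].
Proof.
case/card_gt0P=> y; rewrite inE => /andP[/level_adj H1 /level_adj H2].
have [|[|]] : lv z = (lv x).+2 \/ lv z = lv x \/ lv x = (lv z).+2 by lia.
- by constructor 1.
- by constructor 2.
- by constructor 3.
Qed.

Lemma commonE_up x z : lv z = (lv x).+2 -> common w x z = #|[set u in lower z | adj w x u]|.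
Proof.
move=> zx; rewrite /common; apply: eq_card => y; rewrite !inE.
case: (boolP (adj w x y)) => [/level_adj H1|]; last by rewrite andbF.
case: (boolP (adj w y z)) => [/level_adj H2|] //=.
by symmetry; rewrite andbT; lia.
Qed.

Lemma common_mid x z : lv z = lv x ->
  common w x z = #|lower x :&: lower z| + #|upper x :&: upper z|.
Proof.
move=> zx; rewrite -cardsUI [X in _ + X](_ : _ = 0); last first.
  apply/eqP; rewrite cards_eq0; apply/eqP/setP => y; rewrite !inE.
  by case: (adj w y x) => //=; lia.
rewrite addn0 /common; apply: eq_card => y; rewrite !inE [adj w y x]adjC zx.
case: (boolP (adj w x y)) => [/level_adj H1|] //=.
case: (boolP (adj w y z)) => [/level_adj H2|] //=; last by rewrite !andbF.
lia.
Qed.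

Lemma sum_common x : \sum_(z in sphere w 2 x) common w x z = n * n.-1.
Proof.
transitivity (\sum_(z in sphere w 2 x) #|[set y in [set y | adj w x y] | adj w y z]|).
  by apply: eq_bigr => z _; apply: eq_card => y; rewrite !inE.
rewrite (sum_card_incidence _ _ (adj w)) (eq_bigr (fun=> n.-1)).
  by rewrite sum_nat_const -/(deg w x) degn.
move=> y; rewrite inE => xy.
rewrite -(degn y) /deg [in RHS](cardsD1 x) inE [adj w y x]adjC xy /=.
apply: eq_card => z; rewrite !inE -(andbC (adj w y z)).
case: (boolP (adj w y z)) => yz; last by rewrite andbF.
rewrite andbT /=; apply/(dist2P wG conn bip)/idP => [[]|zx]; first by rewrite eq_sym.
by rewrite eq_sym zx; split=> //; exists y.
Qed.

Definition upward_pairs j := forall x z, lv x = j -> lv z = j.+2 -> 0 < common w x z ->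
  common w x z = 2.

(** The pattern of the hypercube: two [k]-sets differing by one exchange have their intersection as
    the one common neighbour below and their union as the one above. *)
Definition level_pairs k := forall u v, lv u = k -> lv v = k -> u != v ->
  0 < common w u v -> #|lower u :&: lower v| = 1 /\ #|upper u :&: upper v| = 1.

Lemma common_pos u v y : adj w y u -> adj w y v -> 0 < common w u v.
Proof. by move=> yu yv; apply/card_gt0P; exists y; rewrite inE adjC yu yv. Qed.

(** Two common lower neighbours [x] and [y] would form a pair on level [j] with two common upper
    neighbours, namely [u] and [v]. *)
Lemma lower_inter_le1 j u v : level_pairs j -> lv u = j.+1 -> lv v = j.+1 -> u != v ->
  #|lower u :&: lower v| <= 1.
Proof.
move=> Bj uj vj uv; apply/card_le1_eqP => x y /setIP[].
rewrite !in_lower uj vj !eqSS => /andP[xu /eqP xj] /andP[xv _].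
rewrite inE !in_lower uj vj !eqSS => /andP[/andP[yu /eqP yj] /andP[yv _]].
apply/eqP/negPn/negP => xy; rewrite eq_sym in xy.
have ux : adj w u x by rewrite adjC.
have uy : adj w u y by rewrite adjC.
have [_ E] := Bj _ _ (esym xj) (esym yj) xy (common_pos ux uy).
have /card_le1_eqP H : #|upper x :&: upper y| <= 1 by rewrite E.
case/eqP: uv; apply: (H v u); rewrite inE !in_upper ?uj ?vj -xj -yj !eqxx !andbT.
  by rewrite ![adj w v _]adjC xv.
by rewrite ux.
Qed.

(** * Induction step from level [j] to the next shell *)

Section Step.
Variable j : nat.
Hypothesis Bj : level_pairs j.
Hypothesis Alt : forall i, i < j -> upward_pairs i.

Let S k := [set x | lv x == k].

Lemma sum_up_common z : lv z = j.+2 -> \sum_(x in S j) common w x z = j.+2 * j.+1.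
Proof.
move=> zj.
transitivity (\sum_(x in S j) #|[set u in lower z | adj w u x]|).
  apply: eq_bigr => x; rewrite inE => /eqP xj; rewrite commonE_up ?zj ?xj //.
  by apply: eq_card => u; rewrite inE [in RHS]inE adjC.
rewrite (sum_card_incidence _ _ (adj w)) (eq_bigr (fun=> j.+1)).
  by rewrite sum_nat_const card_lower zj.
move=> u; rewrite in_lower zj eqSS => /andP[_ /eqP uj].
rewrite [RHS]uj -(card_lower u); apply: eq_card => x.
by rewrite in_lower !inE -uj eqSS andbC adjC [_ == j]eq_sym.
Qed.

Lemma sum_up_pairs z : lv z = j.+2 ->
  \sum_(x in S j) common w x z * (common w x z).-1 =
  \sum_(u in lower z) \sum_(v in lower z :\ u) #|lower u :&: lower v|.
Proof.
move=> zj.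
transitivity (\sum_(x in S j)
    #|[set u in lower z | adj w u x]| * #|[set u in lower z | adj w u x]|.-1).
  apply: eq_bigr => x; rewrite inE => /eqP xj; rewrite commonE_up ?zj ?xj //.
  suff -> : [set u in lower z | adj w x u] = [set u in lower z | adj w u x] by [].
  by apply/setP => u; rewrite inE [in RHS]inE adjC.
rewrite (sum_card_pairs _ _ (adj w)); apply: eq_bigr => u.
rewrite in_lower zj eqSS => /andP[_ /eqP uj]; apply: eq_bigr => v.
rewrite inE => /andP[_]; rewrite in_lower zj eqSS => /andP[_ /eqP vj].
apply: eq_card => x; rewrite inE in_setI !in_lower inE -uj -vj !eqSS [_ == j]eq_sym.
by rewrite ![adj w _ x]adjC; case: (j == lv x); rewrite ?andbT ?andbF.
Qed.

Lemma lower_pairs_le1 z : lv z = j.+2 -> forall u v, u \in lower z -> v \in lower z ->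
  v != u -> #|lower u :&: lower v| <= 1.
Proof.
move=> zj u v; rewrite !in_lower zj !eqSS => /andP[_ /eqP uj] /andP[_ /eqP vj] vu.
by apply: (lower_inter_le1 Bj) => //; rewrite eq_sym.
Qed.

Lemma non_upward_common x z : lv x = j -> 0 < common w x z -> x != z -> lv z != j.+2 ->
  common w x z = 2.
Proof.
move=> xj c0 xz; case: (common_level c0); rewrite xj => zj; first by rewrite zj eqxx.
  move=> _; rewrite common_mid ?xj //.
  by have [-> ->] := Bj xj zj xz c0.
by move=> _; rewrite commonC; apply: (Alt (i := lv z)); rewrite 1?commonC //; lia.
Qed.

(** By SSP the average of [common w x z] over the second sphere is at least 2. Points of that sphere
    outside level [j.+2] contribute exactly 2 by induction and cancel. *)
Lemma sum_up_ge x : lv x = j ->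
  \sum_(z in S j.+2 | 0 < common w x z) 2 <= \sum_(z in S j.+2 | 0 < common w x z) common w x z.
Proof.
move=> xj; have := sum_common x; have := ssp x; rewrite /SSP degn => sx E.
have : \sum_(z in sphere w 2 x) 2 <= \sum_(z in sphere w 2 x) common w x z.
  rewrite E sum_nat_const; apply: leq_trans (leq_mul sx (leqnn 2)) _.
  by rewrite muln2 bin2 -[leqRHS]odd_double_half leq_addl.
rewrite (bigID (mem (S j.+2))) [leqRHS](bigID (mem (S j.+2))) /=.
have -> : \sum_(z in sphere w 2 x | z \notin S j.+2) common w x z =
          \sum_(z in sphere w 2 x | z \notin S j.+2) 2.
  apply: eq_bigr => z; rewrite (sphere2E wG) // inE => /andP[/andP[xz c0]].
  exact: non_upward_common.
rewrite leq_add2r.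
suff H F : \sum_(z in sphere w 2 x | z \in S j.+2) F z =
   \sum_(z in S j.+2 | 0 < common w x z) F z by rewrite !H.
apply: eq_bigl => z; rewrite (sphere2E wG) // [z \in S _]inE.
case: (lv z =P j.+2) => [zj|_]; last by rewrite andbF.
rewrite andbT /=; case: eqP => // xz.
by move: zj; rewrite -xz xj; lia.
Qed.

Lemma upward_step : upward_pairs j.
Proof.
pose c x z := common w x z.
have sum_pos F x : \sum_(z in S j.+2 | 0 < c x z) F (c x z) =
    \sum_(z in S j.+2) (0 < c x z) * F (c x z).
  rewrite big_mkcondr; apply: eq_bigr => z _.
  by case: (0 < c x z); rewrite ?mul1n ?mul0n.
(* For fixed [z], the left sum counts common lower neighbours of ordered pairs of lower neighbours
   of [z], at most one for each of the [j.+2 * j.+1] pairs; the right sum counts two-step descents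
   from [z], exactly as many. *)
have T1 : \sum_(x in S j) \sum_(z in S j.+2) c x z * (c x z).-1 <=
          \sum_(x in S j) \sum_(z in S j.+2) c x z.
  rewrite exchange_big [leqRHS]exchange_big; apply: leq_sum => z.
  rewrite inE => /eqP zj; rewrite sum_up_pairs // sum_up_common //.
  apply: leq_trans (_ : \sum_(u in lower z) \sum_(v in lower z :\ u) 1 <= _).
    apply: leq_sum => u uz; apply: leq_sum => v /setD1P[vu vz].
    exact: (lower_pairs_le1 zj).
  by rewrite sum_pairs_const card_lower zj.
have T2 : \sum_(x in S j) \sum_(z in S j.+2) (0 < c x z) * 2 <=
          \sum_(x in S j) \sum_(z in S j.+2) (0 < c x z) * c x z.
  apply: leq_sum => x; rewrite inE => /eqP xj.
  by rewrite -(sum_pos (fun=> 2)) -(sum_pos id); apply: sum_up_ge.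
(* The weight [(c - 1) (c - 2)] of a pair [c > 0] is
   [c (c - 1) + 2 - 2 c], so the two bounds add up to a nonpositive total. *)
have T3 : \sum_(x in S j) \sum_(z in S j.+2) (0 < c x z) * 2 +
     \sum_(x in S j) \sum_(z in S j.+2) c x z * (c x z).-1 =
     \sum_(x in S j) \sum_(z in S j.+2) (c x z).-1 * (c x z).-2 +
     (\sum_(x in S j) \sum_(z in S j.+2) (0 < c x z) * c x z +
      \sum_(x in S j) \sum_(z in S j.+2) c x z).
  rewrite -!big_split; apply: eq_bigr => x _; rewrite -!big_split; apply: eq_bigr => z _ /=.
  by case: (c x z) => [|[|[|k]]] //=; nia.
have T4 : \sum_(x in S j) \sum_(z in S j.+2) (c x z).-1 * (c x z).-2 = 0.
  by move: (leq_add T2 T1); rewrite T3; lia.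
move=> x z xj zj c0.
have xS : x \in S j by rewrite inE xj.
(* [T4] leaves only the counts 0, 1 and 2; [sum_up_ge] then excludes 1. *)
have c2 z' : z' \in S j.+2 -> c x z' <= 2.
  move=> zS; move/eqP: T4; rewrite sum_nat_eq0 => /forall_inP/(_ x xS).
  rewrite sum_nat_eq0 => /forall_inP/(_ z' zS).
  by case: (c x z') => [|[|[|k]]].
apply: (@sum_leq_eq _ (fun z => (z \in S j.+2) && (0 < c x z)) (c x) (fun=> 2)).
- by move=> z' /andP[/c2].
- exact: sum_up_ge.
- by rewrite inE zj eqxx.
Qed.

Lemma all_common2 x z : lv x = j -> z \in sphere w 2 x -> common w x z = 2.
Proof.
move=> xj; rewrite (sphere2E wG) // => /andP[xz c0].
have [zj|zj] := eqVneq (lv z) j.+2; first exact: upward_step.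
exact: non_upward_common.
Qed.

(** NCP allows at most one [z] for each pair of neighbours of [x]. Since all counts are 2, the total
    over pairs equals the sum of [common w x z], that is [n * n.-1], so each pair has exactly
    one. *)
Lemma quad_unique x u v : lv x = j -> adj w x u -> adj w x v -> v != u ->
  #|[set z in sphere w 2 x | adj w u z && adj w v z]| = 1.
Proof.
move=> xj xu xv vu.
pose A := [set y | adj w x y].
apply: (@sum_pairs_eq1 _ A (fun u v => #|[set z in sphere w 2 x | adj w u z && adj w v z]|));
  rewrite ?inE //.
  move=> a a'; rewrite !inE => xa xa' ne; rewrite eq_sym in ne.
  apply: leq_trans (ncp (fun z => all_common2 xj) xa xa' ne).
  by rewrite leq_eqVlt; apply/orP; left; apply/eqP/eq_card => z; rewrite !inE [adj w z a']adjC.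
rewrite -(sum_card_pairs _ _ (adj w)) -/(deg w x) degn -(sum_common x).
apply: leq_sum => z zS; rewrite (_ : #|_| = 2) ?all_common2 //.
by rewrite -[RHS](all_common2 xj zS); apply: eq_card => y; rewrite !inE.
Qed.

Lemma level_step : level_pairs j.+1.
Proof.
move=> u v uj vj uv c0.
have le1 := lower_inter_le1 Bj uj vj uv.
have low1 : #|lower u :&: lower v| = 1.
  (* If nothing lies below both, they have a common upper neighbour [z]. As upward counts are 2, the
     counts bounded in [T1] are equal for this [z], so every pair of its lower neighbours does have
     a common lower neighbour. *)
  apply/eqP; rewrite eqn_leq le1 lt0n; apply/negP => /eqP l0.
  move: c0; rewrite common_mid ?uj ?vj // l0 add0n => /card_gt0P[z].
  rewrite inE !upper_lower => /andP[uz vz].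
  have zj : lv z = j.+2 by move: uz; rewrite in_lower uj => /andP[_ /eqP].
  have := @sum_pairs_eq1 _ (lower z) (fun u v => #|lower u :&: lower v|)
    (lower_pairs_le1 zj) _ u v uz vz.
  rewrite l0 eq_sym => /(_ _ uv) H; suff : 0 = 1 by [].
  apply: H; rewrite -sum_up_pairs // card_lower zj /= -(sum_up_common zj).
  apply: leq_sum => x; rewrite inE => /eqP xj.
  have [->//|c0] := posnP (common w x z).
  by rewrite (upward_step xj zj c0).
split=> //.
(* Apply [quad_unique] at the common lower neighbour [x]: a further common neighbour cannot lie
   below, where [x] is the only one, so it lies above. *)
have /card_gt0P[x] : 0 < #|lower u :&: lower v| by rewrite low1.
rewrite inE !in_lower uj vj !eqSS => /andP[/andP[xu /eqP xj] /andP[xv _]].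
have vu : v != u by rewrite eq_sym.
rewrite -(quad_unique (esym xj) xu xv vu); apply: eq_card => z.
rewrite !inE [adj w z u]adjC [adj w z v]adjC uj vj.
case: (boolP (adj w u z)) => uz; last by rewrite andbF.
case: (boolP (adj w v z)) => vz; last by rewrite !andbF.
rewrite /= andbb andbT; apply/idP/(dist2P wG conn bip) => [lz|[xz _]].
  by split; [apply: contraTneq lz => <-; rewrite -xj; lia | exists u].
rewrite ltnNge; apply: contra xz => lz.
have H (a : V) : adj w a z -> lv a = j.+1 -> z \in lower a.
  by move=> az aj; rewrite in_lower adjC az /=; case/level_adj: az; lia.
move/eqP/cards1P: low1 => [y yE].
have : z \in lower u :&: lower v by rewrite inE !H.
have : x \in lower u :&: lower v by rewrite inE !in_lower uj vj xu xv -xj !eqxx.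
by rewrite yE !inE => /eqP-> /eqP->.
Qed.

End Step.

Lemma shell_pairs k : level_pairs k /\ forall i, i < k -> upward_pairs i.
Proof.
elim: k => [|k [Bk Ak]].
  split=> // u v; move/eqP; rewrite (dist_eq0 conn) => /eqP->.
  by move/eqP; rewrite (dist_eq0 conn) => /eqP->; rewrite eqxx.
split; first exact: level_step.
by move=> i; rewrite ltnS leq_eqVlt => /orP[/eqP->|/Ak//]; apply: upward_step.
Qed.

(** In the hypercube rooted at the empty set these are the singletons contained in [v]. *)
Definition atoms v := [set y | (lv y == 1) && ((d y v).+1 == lv v)].

Lemma atoms_lower u v : u \in lower v -> atoms u \subset atoms v.
Proof.
rewrite in_lower => /andP[uv /eqP vu]; apply/subsetP => y; rewrite !inE.
move=> /andP[/eqP y1 /eqP yu]; rewrite y1 eqxx /=.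
have vu' : adj w v u by rewrite adjC.
have := dist_adj w0 conn y vu'; rewrite (distC wC conn v) (distC wC conn u).
have := dist_triangle conn y v x0; rewrite (distC wC conn v y) y1.
lia.
Qed.

Lemma atoms_bigcup v : 1 < lv v -> atoms v = \bigcup_(u in lower v) atoms u.
Proof.
move=> v1; apply/eqP; rewrite eqEsubset; apply/andP; split; last first.
  by apply/bigcupsP => u; apply: atoms_lower.
apply/subsetP => y; rewrite inE => /andP[/eqP y1 /eqP yv].
have dv : d v y = (lv v).-2.+1 by rewrite (distC wC conn); lia.
have [u vu du] := dist_pred w0 conn dv.
have uv : u \in lower v.
  rewrite in_lower adjC vu /=; have := dist_triangle conn y u x0.
  by case/level_adj: vu; rewrite du y1; lia.
apply/bigcupP; exists u => //; rewrite inE y1 eqxx (distC wC conn) du /=.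
by move: uv; rewrite in_lower => /andP[_ /eqP]; lia.
Qed.

Definition atoms_card k := forall v, lv v = k -> #|atoms v| = k.
Definition atoms_inj k := forall u v, lv u = k -> lv v = k -> atoms u = atoms v -> u = v.

(** The [k.+1] lower neighbours of [v] have distinct atom sets, all of them [k]-subsets of the
    [k.+1] atoms of [v]; there are no other [k]-subsets. *)
Lemma lower_atoms k v (B : {set V}) :
  atoms_card k -> atoms_card k.+1 -> atoms_inj k -> lv v = k.+1 ->
  B \subset atoms v -> #|B| = k -> exists2 u, u \in lower v & atoms u = B.
Proof.
move=> ck ck1 ik vk Bv Bk.
have lk u : u \in lower v -> lv u = k.
  by rewrite in_lower vk eqSS => /andP[_ /eqP].
have E : [set atoms u | u in lower v] = [set C : {set V} | C \subset atoms v & #|C| == k].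
  apply/eqP; rewrite eqEcard; apply/andP; split.
    apply/subsetP => _ /imsetP[u uv ->]; rewrite inE atoms_lower //=.
    by rewrite ck // lk.
  rewrite cards_draws ck1 // binSn card_in_imset ?card_lower ?vk //.
  by move=> u u' /lk uk /lk uk'; apply: ik.
have : B \in [set C : {set V} | C \subset atoms v & #|C| == k] by rewrite inE Bv Bk eqxx.
by rewrite -E => /imsetP[u uv ->]; exists u.
Qed.

Lemma atoms_step k : atoms_card k -> atoms_inj k -> atoms_card k.+1 -> atoms_inj k.+1 ->
  atoms_card k.+2 /\ atoms_inj k.+2.
Proof.
move=> ck ik ck1 ik1; have [Bk1 Ak1] := shell_pairs k.+1.
have two z : lv z = k.+2 -> exists u v, [/\ u \in lower z, v \in lower z & u != v].
  move=> zk; have /card_gt1P[u [v [uz vz uv]]] : 1 < #|lower z| by rewrite card_lower zk.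
  by exists u, v.
have lk z u : lv z = k.+2 -> u \in lower z -> adj w u z /\ lv u = k.+1.
  by move=> zk; rewrite in_lower zk eqSS => /andP[uz /eqP].
have meet z u v : lv z = k.+2 -> u \in lower z -> v \in lower z -> u != v ->
    exists x, [/\ lower u :&: lower v = [set x], lv x = k & atoms u :&: atoms v = atoms x].
  move=> zk uz vz uv; have [uz' uk] := lk _ _ zk uz; have [vz' vk] := lk _ _ zk vz.
  have c0 : 0 < common w u v by apply: (common_pos (y := z)); rewrite adjC.
  have [/eqP/cards1P[x xE] _] := Bk1 _ _ uk vk uv c0; exists x.
  have : x \in lower u :&: lower v by rewrite xE inE.
  case/setIP=> xu xv; have xk : lv x = k by move: xu; rewrite in_lower uk eqSS => /andP[_ /eqP].
  split=> //; apply/esym/eqP; rewrite eqEcard subsetI !atoms_lower //= ck //.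
  rewrite -ltnS -(ck1 _ uk) ltn_neqAle subset_leq_card ?subsetIl // andbT.
  apply: contra uv => /eqP E; apply/eqP/ik1 => //.
  have uI : atoms u :&: atoms v = atoms u by apply/eqP; rewrite eqEcard subsetIl E leqnn.
  by apply/eqP; rewrite eqEcard (ck1 _ uk) (ck1 _ vk) leqnn andbT -uI subsetIr.
have card2 : atoms_card k.+2.
  move=> z zk; have [u [v [uz vz uv]]] := two z zk.
  have [x [xE xk xA]] := meet z u v zk uz vz uv.
  have [uz' uk] := lk _ _ zk uz; have [vz' vk] := lk _ _ zk vz.
  (* Two lower neighbours already carry all atoms of [z], and their atom sets meet in [k] elements,
     so the union has [k.+2]. *)
  have -> : atoms z = atoms u :|: atoms v.
    apply/eqP; rewrite eqEsubset subUset !atoms_lower //= andbT.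
    rewrite (atoms_bigcup (v := z)) ?zk //; apply/bigcupsP => t tz.
    have [tz' tk] := lk _ _ zk tz.
    have [->|tu] := eqVneq t u; first exact: subsetUl.
    have [->|tv] := eqVneq t v; first exact: subsetUr.
    have [y [yE yk yA]] := meet z t u zk tz uz tu.
    have [y' [yE' yk' yA']] := meet z t v zk tz vz tv.
    (* Otherwise [y] and [z] would have the three common neighbours [t], [u], [v], against
       [upward_pairs]. Being distinct, [y] and [y'] together carry all atoms of [t]. *)
    have yy' : y != y'.
      apply/eqP => E; have yt : y \in lower t :&: lower u by rewrite yE inE.
      have yt' : y \in lower t :&: lower v by rewrite yE' E inE.
      case/setIP: yt => yt yu; case/setIP: yt' => _ yv.
      have [yat yau yav] : [/\ adj w y t, adj w y u & adj w y v].
        by move: yt yu yv; rewrite !in_lower => /andP[? _] /andP[? _] /andP[? _].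
      have c0 : 0 < common w y z by apply/card_gt0P; exists t; rewrite inE yat.
      have := Ak1 k (ltnSn k) y z yk zk c0.
      suff /subset_leq_card : [set t; u; v] \subset [set a | adj w y a && adj w a z].
        rewrite -/(common w y z) => H E2; move: H; rewrite E2.
        rewrite -setUA cardsU1 cards2 uv !inE negb_or tu tv //.
      by apply/subsetP => a; rewrite !inE => /orP[/orP[]|] /eqP->;
        rewrite ?yat ?yau ?yav ?tz' ?uz' ?vz'.
    have yU : atoms y :|: atoms y' = atoms t.
      apply/eqP; rewrite eqEcard subUset -{1}yA -{1}yA' !subsetIl /= ck1 //.
      have : #|atoms y| < #|atoms y :|: atoms y'|.
        apply: proper_card; rewrite properE subsetUl /= subUset subxx /=.
        apply: contra yy' => sub; apply/eqP/ik => //.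
        by apply/esym/eqP; rewrite eqEcard sub (ck _ yk) (ck _ yk') /=.
      by rewrite ck.
    by rewrite -yU -yA -yA' setUSS // subsetIr.
  have := cardsUI (atoms u) (atoms v); rewrite xA (ck1 _ uk) (ck1 _ vk) (ck _ xk); lia.
split=> // z z' zk zk' E.
(* Equal atom sets force equal sets of lower neighbours, and two of these have only one common upper
   neighbour. *)
have sub u : u \in lower z -> u \in lower z'.
  move=> uz; have [_ uk] := lk _ _ zk uz.
  have Bz : atoms u \subset atoms z' by rewrite -E atoms_lower.
  have [u' uz' uE] := lower_atoms ck1 card2 ik1 zk' Bz (ck1 _ uk).
  have [_ uk'] := lk _ _ zk' uz'.
  by rewrite -(ik1 _ _ uk' uk uE).
have [u [v [uz vz uv]]] := two z zk.
have [uz' uk] := lk _ _ zk uz; have [vz' vk] := lk _ _ zk vz.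
have c0 : 0 < common w u v by apply: (common_pos (y := z)); rewrite adjC.
have [_ U1] := Bk1 _ _ uk vk uv c0.
have /card_le1_eqP H : #|upper u :&: upper v| <= 1 by rewrite U1.
by apply: H; rewrite inE !upper_lower ?uz ?vz // !sub.
Qed.

(** Two consecutive levels are carried along because [atoms_step] looks two levels down. *)
Lemma atoms_all k : (atoms_card k /\ atoms_inj k) /\ (atoms_card k.+1 /\ atoms_inj k.+1).
Proof.
elim: k => [|k [[ck ik] [ck1 ik1]]]; last by split=> //; apply: atoms_step.
split; split.
- move=> v; move/eqP; rewrite (dist_eq0 conn) => /eqP->.
  by apply/eqP; rewrite cards_eq0; apply/eqP/setP => y; rewrite !inE (distxx conn) andbF.
- move=> u v; move/eqP; rewrite (dist_eq0 conn) => /eqP->.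
  by move/eqP; rewrite (dist_eq0 conn) => /eqP->.
- move=> v v1; rewrite (_ : atoms v = [set v]) ?cards1 //; apply/setP => y.
  rewrite !inE v1 eqSS (dist_eq0 conn); case: (y =P v) => [->|_]; last by rewrite andbF.
  by rewrite v1.
- move=> u v u1 v1 /setP /(_ u); rewrite !inE u1 v1 !eqSS (distxx conn) eqxx /=.
  by rewrite (dist_eq0 conn) => /esym/eqP.
Qed.

Lemma card_atoms v : #|atoms v| = lv v.
Proof. by have [[ck _] _] := atoms_all (lv v); apply: ck. Qed.

Lemma inj_atoms : injective atoms.
Proof.
move=> u v E; have uv : lv u = lv v by rewrite -!card_atoms E.
by have [[_ ik] _] := atoms_all (lv v); apply: ik.
Qed.

Lemma atoms_sub1 v : atoms v \subset [set y | adj w x0 y].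
Proof.
by apply/subsetP => y; rewrite !inE => /andP[+ _]; rewrite (dist_eq1 w0 conn) adjC.
Qed.

Lemma adj_atoms_lower u v : lv v = (lv u).+1 -> adj w u v = (atoms u \subset atoms v).
Proof.
move=> vu; apply/idP/idP => [uv|sub].
  by apply: atoms_lower; rewrite in_lower uv vu eqxx.
have [[ck ik] [ck1 _]] := atoms_all (lv u).
have [t tv /inj_atoms tu] := lower_atoms ck ck1 ik vu sub (card_atoms u).
by move: tv; rewrite tu in_lower => /andP[].
Qed.

Lemma card_symdiff (T : finType) (A B : {set T}) :
  (#|(A :|: B) :\: (A :&: B)| == 1) =
  (#|B| == #|A|.+1) && (A \subset B) || (#|A| == #|B|.+1) && (B \subset A).
Proof.
rewrite cardsD (setIidPr _); last by apply: subset_trans (subsetIl _ _) (subsetUl _ _).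
have UI := cardsUI A B; have IA := subset_leq_card (subsetIl A B).
have IB := subset_leq_card (subsetIr A B).
have sA : (A \subset B) = (#|A| <= #|A :&: B|).
  apply/idP/idP => [/setIidPl->//|H]; apply/setIidPl/eqP.
  by rewrite eqEcard subsetIl.
have sB : (B \subset A) = (#|B| <= #|A :&: B|).
  apply/idP/idP => [/setIidPr->//|H]; apply/setIidPr/eqP.
  by rewrite eqEcard subsetIr.
by rewrite sA sB; lia.
Qed.

Lemma adj_atoms u v : adj w u v = (#|(atoms u :|: atoms v) :\: (atoms u :&: atoms v)| == 1).
Proof.
rewrite card_symdiff !card_atoms; apply/idP/orP.
  move=> uv; case: (level_adj uv) => E; [right | left]; rewrite E eqxx.
    by rewrite -adj_atoms_lower // adjC.
  by rewrite -adj_atoms_lower.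
case=> /andP[/eqP E]; rewrite -adj_atoms_lower //.
by rewrite adjC.
Qed.

(** Remove an element [b] of [B] and realize the rest by [u]. The upper neighbours of [u] have
    distinct atom sets, each adding one atom, and there are as many of them as candidates for that
    atom; so [b] is among those added. *)
Lemma atoms_surj (B : {set V}) : B \subset [set y | adj w x0 y] -> exists v, atoms v = B.
Proof.
have [k] := ubnP #|B|; elim: k B => // k IHk B Bk sB.
have [->|[b bB]] := set_0Vmem B.
  exists x0; apply/eqP; rewrite -cards_eq0 card_atoms (distxx conn) //.
have [u uE] : exists u, atoms u = B :\ b.
  apply: IHk; last by apply: subset_trans (subsetDl _ _) sB.
  by move: Bk; rewrite (cardsD1 b) bB.
pose X := [set y | adj w x0 y].
have uX : atoms u \subset X := atoms_sub1 u.
have E : [set atoms v | v in upper u] = [set y |: atoms u | y in X :\: atoms u].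
  apply/eqP; rewrite eqEcard; apply/andP; split.
    apply/subsetP => _ /imsetP[v vu ->].
    have uv : u \in lower v by rewrite -upper_lower.
    have sub := atoms_lower uv.
    have : #|atoms v :\: atoms u| == 1.
      rewrite cardsD (setIidPr sub) !card_atoms.
      by move: uv; rewrite in_lower => /andP[_ /eqP->]; rewrite subSnn.
    case/cards1P => y yE; apply/imsetP; exists y.
      have : y \in atoms v :\: atoms u by rewrite yE inE.
      rewrite !inE => /andP[-> yv] /=.
      by have := subsetP (atoms_sub1 v) y; rewrite !inE; apply.
    by rewrite -[LHS](setID _ (atoms u)) yE (setIidPr sub) setUC.
  rewrite [leqRHS]card_imset; last exact: inj_atoms.
  apply: leq_trans (leq_imset_card _ _) _.
  by rewrite card_upper cardsD (setIidPr uX) card_atoms -/(deg w x0) degn.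
have : B \in [set y |: atoms u | y in X :\: atoms u].
  apply/imsetP; exists b; last by rewrite uE setD1K.
  by rewrite inE uE !inE eqxx /=; have := subsetP sB b bB; rewrite inE.
by rewrite -E => /imsetP[v _ ->]; exists v.
Qed.

Lemma shells_hypercube : is_hypercube w n.
Proof.
pose X := [set y | adj w x0 y]; have Xn : #|X| = n := degn x0.
pose e (i : 'I_n) : V := enum_val (cast_ord (esym Xn) i).
have eX i : e i \in X by apply: enum_valP.
have eI : injective e by move=> i i' /enum_val_inj /cast_ord_inj.
have eS y : y \in X -> exists i, e i = y.
  move=> yX; exists (cast_ord Xn (enum_rank_in yX y)).
  by rewrite /e cast_ordK enum_rankK_in.
pose f v := e @^-1: atoms v.
have eK (C : {set V}) : C \subset X -> e @: (e @^-1: C) = C.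
  move=> CX; apply/setP => y; apply/imsetP/idP => [[i iC ->]|yC]; first by rewrite inE in iC.
  by have [i iE] := eS y (subsetP CX y yC); exists i => //; rewrite inE iE.
have fK v : e @: f v = atoms v by apply/eK/atoms_sub1.
have fI : injective f by move=> u v uv; apply: inj_atoms; rewrite -!fK uv.
have fS B : exists v, f v == B.
  have [|v vE] := @atoms_surj (e @: B).
    by apply/subsetP => _ /imsetP[i _ ->]; apply: eX.
  by exists v; apply/eqP/(imset_inj eI); rewrite fK.
exists f; split.
  exists (fun B => xchoose (fS B)) => [v|B]; last by apply/eqP/(xchooseP (fS B)).
  by apply/fI/eqP/(xchooseP (fS (f v))).
move=> u v; rewrite /hcube_adj adj_atoms -preimsetI -preimsetU -preimsetD.
rewrite -[in RHS](card_imset _ eI) eK //.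
by apply: subset_trans (subsetDl _ _) _; rewrite subUset !atoms_sub1.
Qed.

End Shells.

(** * Curvature and spectrum of the hypercube *)

Section CommutingInvolutions.
Variables (R : realFieldType) (V : finType) (w : V -> V -> R) (m : V -> R).
Variables (N : nat) (t : 'I_N -> V -> V) (k : R).
Hypothesis tK : forall i, involutive (t i).
Hypothesis tC : forall i j x, t i (t j x) = t j (t i x).
Hypothesis rate_sum : forall x (F : V -> R), \sum_y rate w m x y * F y = k * \sum_i F (t i x).

(** For commuting [t i], [Gamma2] is a sum of squares of mixed second differences. Since [t i] is an
    involution, the terms with equal indices are [4 (f (t i x) - f x) ^+ 2] and add up to
    [2 k Gamma f]. *)
Lemma involutions_CD : CDinf w m (2%:R * k).
Proof.
have LE f x : Lap w m f x = k * \sum_i (f (t i x) - f x) by rewrite LapE rate_sum.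
have GE f g x : Gam w m f g x = k / 2%:R * \sum_i (f (t i x) - f x) * (g (t i x) - g x).
  by rewrite GamE rate_sum mulrAC.
move=> f x.
have -> : Gam2 w m f f x =
    k ^+ 2 / 4%:R * \sum_i \sum_j (f (t i (t j x)) - f (t i x) - f (t j x) + f x) ^+ 2.
  have T1 : Lap w m (Gam w m f f) x = k ^+ 2 / 2%:R * \sum_i \sum_j
      ((f (t i (t j x)) - f (t j x)) ^+ 2 - (f (t i x) - f x) ^+ 2).
    rewrite LE exchange_big !mulr_sumr; apply: eq_bigr => j _ /=.
    by rewrite !GE sumrB; field.
  have T2 : Gam w m f (Lap w m f) x = k ^+ 2 / 2%:R * \sum_i \sum_j
      (f (t i x) - f x) * (f (t i (t j x)) - f (t i x) - f (t j x) + f x).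
    rewrite GE !mulr_sumr; apply: eq_bigr => i _; rewrite !LE -mulrBr -sumrB.
    by rewrite !mulr_sumr; apply: eq_bigr => j _; rewrite [t j (t i x)]tC; field.
  transitivity ((Lap w m (Gam w m f f) x - Gam w m f (Lap w m f) x
    - Gam w m f (Lap w m f) x) / 2%:R); first by [].
  rewrite T1 T2 !mulr_sumr -!sumrB mulr_suml; apply: eq_bigr => i _.
  by rewrite !mulr_sumr -!sumrB mulr_suml; apply: eq_bigr => j _; field.
rewrite GE.
have le_diag : \sum_i 4%:R * (f (t i x) - f x) ^+ 2 <=
    \sum_i \sum_j (f (t i (t j x)) - f (t i x) - f (t j x) + f x) ^+ 2.
  apply: ler_sum => i _; rewrite (bigD1 i) //= tK.
  have -> : f x - f (t i x) - f (t i x) + f x = - 2%:R * (f (t i x) - f x) by ring.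
  by rewrite exprMn sqrrN -natrX lerDl sumr_ge0 // => j _; apply: sqr_ge0.
have k0 : 0 <= k ^+ 2 / 4%:R by rewrite divr_ge0 ?sqr_ge0 ?ler0n.
apply: le_trans (ler_wpM2l k0 le_diag).
rewrite le_eqVlt; apply/orP; left; apply/eqP.
by rewrite !mulr_sumr; apply: eq_bigr => i _; field.
Qed.

End CommutingInvolutions.

(** * Subsets under symmetric difference and their characters *)

Section SymmetricDifference.
Variable T : finType.
Implicit Types A B C : {set T}.

Definition symdiff A B := (A :|: B) :\: (A :&: B).

Lemma in_symdiff A B i : (i \in symdiff A B) = (i \in A) (+) (i \in B).
Proof. by rewrite !inE; case: (i \in A) (i \in B) => [] []. Qed.

Lemma symdiffK A B : symdiff A (symdiff A B) = B.
Proof. by apply/setP => i; rewrite !in_symdiff addKb. Qed.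

Lemma symdiffKr A B : symdiff (symdiff A B) B = A.
Proof. by apply/setP => i; rewrite !in_symdiff addbK. Qed.

Lemma symdiffAC A B C : symdiff (symdiff A B) C = symdiff (symdiff A C) B.
Proof. by apply/setP => i; rewrite !in_symdiff addbAC. Qed.

Variable R : realFieldType.

(** The characters of the group of subsets under symmetric difference, with values
    [(-1) ^+ #|A :&: B|]. *)
Definition walsh A B : R := \prod_i (-1) ^+ ((i \in A) && (i \in B)).

Lemma walshC A B : walsh A B = walsh B A.
Proof. by apply: eq_bigr => i _; rewrite andbC. Qed.

Lemma walsh_symdiff A B C : walsh A (symdiff B C) = walsh A B * walsh A C.
Proof.
rewrite -big_split; apply: eq_bigr => i _ /=.
by rewrite in_symdiff andb_addr signr_addb.
Qed.

Lemma walsh1 A i : walsh A [set i] = (-1) ^+ (i \in A).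
Proof.
rewrite /walsh (bigD1 i) //= inE eqxx andbT big1 ?mulr1 // => j /negPf ji.
by rewrite inE ji andbF.
Qed.

Lemma walsh0 B : walsh set0 B = 1.
Proof. by rewrite /walsh big1 // => i _; rewrite inE. Qed.

End SymmetricDifference.

Lemma nth_sorted_count (R : realFieldType) (s : seq R) (c : R) k : sorted <=%R s ->
  (count (fun a => (a < c)%R) s <= k)%N -> (k < count (fun a => (a <= c)%R) s)%N -> nth 0 s k = c.
Proof.
move=> srt lt_c le_c.
have ks : (k < size s)%N by apply: leq_trans le_c (count_size _ _).
have mono i j : (i <= j)%N -> (j < size s)%N -> nth 0 s i <= nth 0 s j.
  move=> ij js; apply: (sorted_leq_nth le_trans le_refl) => //; rewrite ?inE //.
  exact: leq_ltn_trans js.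
apply/eqP; rewrite eq_le; apply/andP; split; rewrite leNgt; apply/negP => sk.
  move: le_c; rewrite ltnNge => /negP[]; rewrite -[s in count _ s](cat_take_drop k) count_cat.
  rewrite -[leqRHS]addn0; apply: leq_add.
    by apply: leq_trans (count_size _ _) _; rewrite size_take ks.
  rewrite leqNgt -has_count; apply/hasPn => a /(nthP 0)[i].
  rewrite size_drop => ik <-; rewrite nth_drop -ltNge (lt_le_trans sk) // mono ?leq_addr //.
  by rewrite -ltn_subRL.
move: lt_c; rewrite leqNgt => /negP[]; rewrite -[s in count _ s](cat_take_drop k.+1) count_cat.
apply: leq_trans (leq_addr _ _).
have /eqP -> : count (fun a => a < c) (take k.+1 s) == size (take k.+1 s).
  rewrite -all_count; apply/(all_nthP 0) => i; rewrite size_takel // => ik.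
  by rewrite nth_take // (le_lt_trans _ sk) // mono.
by rewrite size_takel.
Qed.

Section Hypercube.
Variables (R : realFieldType) (V : finType) (w : V -> V -> R) (m : V -> R) (K : R) (N : nat).
Hypothesis wG : weighted_graph w m.
Hypothesis conn : connected w.
Hypothesis V1 : (1 < #|V|)%N.
Hypothesis K0 : 0 < K.
Hypothesis cE : const_edge_deg w m (K / 2%:R).
Variables (f : V -> {set 'I_N}) (g : {set 'I_N} -> V).
Hypotheses (fK : cancel f g) (gK : cancel g f).
Hypothesis fadj : forall x y, adj w x y = hcube_adj (f x) (f y).

Definition toggle i x := g (symdiff (f x) [set i]).

Lemma toggleE i x : f (toggle i x) = symdiff (f x) [set i].
Proof. by rewrite /toggle gK. Qed.

Lemma toggleK i : involutive (toggle i).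
Proof. by move=> x; apply: (can_inj fK); rewrite !toggleE symdiffKr. Qed.

Lemma toggleC i j x : toggle i (toggle j x) = toggle j (toggle i x).
Proof. by apply: (can_inj fK); rewrite !toggleE symdiffAC. Qed.

Lemma toggle_inj x : injective (toggle^~ x).
Proof.
move=> i j /(congr1 f); rewrite !toggleE => /(congr1 (symdiff (f x))).
by rewrite !symdiffK => /set1_inj.
Qed.

Lemma nbr_toggle x : [set y | adj w x y] = [set toggle i x | i : 'I_N].
Proof.
apply/setP => y; rewrite inE fadj; apply/cards1P/imsetP => [[i iE]|[i _ ->]].
  by exists i => //; apply: (can_inj fK); rewrite toggleE -iE symdiffK.
by exists i; rewrite toggleE -/(symdiff _ _) symdiffK.
Qed.

Lemma hypercube_deg x : deg w x = N.
Proof. by rewrite /deg nbr_toggle card_imset ?cardsT ?card_ord //; apply: toggle_inj. Qed.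

Lemma hypercube_rate_sum x (F : V -> R) :
  \sum_y rate w m x y * F y = K / 2%:R * \sum_i F (toggle i x).
Proof.
rewrite mulr_sumr; under eq_bigr do rewrite (const_edge_rate wG _ cE) ?divr_gt0 ?ltr0n // -mulrA.
transitivity (\sum_(y in [set y | adj w x y]) K / 2%:R * F y).
  rewrite [RHS]big_mkcond; apply: eq_bigr => y _; rewrite inE.
  by case: (adj w x y); rewrite ?mul1r ?mul0r ?mulr0.
rewrite nbr_toggle big_imset /=; last by move=> i j _ _; apply: toggle_inj.
by apply: eq_bigl => i; rewrite inE.
Qed.

Lemma hypercube_CD : CDinf w m K.
Proof.
have -> : K = 2%:R * (K / 2%:R) by field.
exact: (involutions_CD toggleK toggleC hypercube_rate_sum).
Qed.

Lemma walsh_eigenfun (A : {set 'I_N}) : eigenfun w m (K * #|A|%:R) (fun x => walsh R A (f x)).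
Proof.
move=> x; rewrite LapE hypercube_rate_sum.
under eq_bigr do rewrite toggleE walsh_symdiff walsh1.
rewrite (eq_bigr (fun i => - 2%:R * walsh R A (f x) * (i \in A)%:R)); last first.
  by move=> i _; case: (i \in A); rewrite ?expr1 ?expr0 /=; ring.
rewrite -mulr_sumr; have -> : \sum_(i : 'I_N) (i \in A)%:R = #|A|%:R :> R.
  rewrite -sum1_card natr_sum [RHS]big_mkcond; apply: eq_bigr => i _.
  by case: (i \in A).
by field.
Qed.

(** Toggling an element of [A] permutes the vertices and reverses the sign of the character. *)
Lemma sum_walsh (A : {set 'I_N}) : A != set0 -> \sum_x walsh R A (f x) = 0.
Proof.
case/set0Pn => i iA; apply/eqP; rewrite -[_ == 0](mulrn_eq0 _ 2) mulr2n.
rewrite {2}(reindex_inj (inv_inj (toggleK i))) -big_split big1 // => x _ /=.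
by rewrite toggleE walsh_symdiff walsh1 iA expr1 mulrN1 subrr.
Qed.

Definition walsh_mx : 'M[R]_#|V| :=
  \matrix_(i, j) walsh R (f (enum_val i)) (f (enum_val j)).

(** Orthogonality of characters: the product of two rows sums the character of their symmetric
    difference, so the square of [walsh_mx] is [#|V|] times the identity. *)
Lemma walsh_mx_unit : walsh_mx \in unitmx.
Proof.
have VN : #|V|%:R != 0 :> R by rewrite pnatr_eq0 -lt0n ltnW.
suff /mulmx1_unit[] : walsh_mx *m (#|V|%:R^-1 *: walsh_mx) = 1%:M by [].
apply/matrixP => i j; rewrite -scalemxAr !mxE.
pose A := symdiff (f (enum_val i)) (f (enum_val j)).
rewrite (eq_bigr (fun l => walsh R A (f (enum_val l)))); last first.
  by move=> l _; rewrite !mxE [RHS]walshC walsh_symdiff ![walsh _ (f (enum_val l)) _]walshC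
     [walsh _ (f (enum_val j)) _]walshC ?[walsh _ (f (enum_val l)) _]walshC.
rewrite -(big_enum_val (fun x => walsh R A (f x))) /=.
have [E|ij] := eqVneq i j.
  rewrite (eq_bigr (fun=> 1)) ?sumr_const ?mulVf // => x _.
  rewrite (_ : A = set0) ?walsh0 //; apply/setP => l.
  by rewrite /A E in_symdiff addbb inE.
rewrite sum_walsh ?mulr0 //; apply: contra ij => /eqP A0; apply/eqP/enum_val_inj/(can_inj fK).
by rewrite -[RHS](symdiffK (f (enum_val i))) -/A A0; apply/setP => l; rewrite in_symdiff inE addbF.
Qed.

Lemma hypercube_char_poly : char_poly (negLap_mx w m) =
  \prod_(a <- [seq K * #|f x|%:R | x <- enum V]) ('X - a%:P).
Proof.
rewrite -char_poly_tr.
have E : walsh_mx *m (negLap_mx w m)^T =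
    diag_mx (\row_i (K * #|f (enum_val i)|%:R)) *m walsh_mx.
  apply/row_matrixP => i; rewrite !row_mul row_diag_mx -scalemxAl -rowE; apply: fun_of_row_inj => x.
  have wE : fun_of_row (row i walsh_mx) =1 fun x => walsh R (f (enum_val i)) (f x).
    by move=> y; rewrite /fun_of_row !mxE enum_rankK.
  rewrite fun_of_row_Lap (eq_Lap w m wE) walsh_eigenfun opprK fun_of_rowZ wE.
  by rewrite mxE.
rewrite (similar_char_poly walsh_mx_unit E) char_poly_trig ?diag_mx_is_trig //.
rewrite big_map big_enum /= [RHS](big_enum_val (fun x => 'X - (K * #|f x|%:R)%:P)) /=.
by apply: eq_bigr => i _; rewrite !mxE eqxx mulr1n.
Qed.

Lemma hypercube_lambda : lambda_eq w m (degmax w) K.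
Proof.
have -> : degmax w = N.
  have [x _] := card_gt0P (ltnW V1); apply/eqP; rewrite eqn_leq; apply/andP; split.
    by apply/bigop.bigmax_leqP => y _; rewrite hypercube_deg.
  by rewrite -{1}(hypercube_deg x); apply: (@bigop.leq_bigmax _ (deg w) x).
pose s := [seq K * #|f x|%:R | x <- enum V].
exists (sort <=%R s); split.
  split; first by apply: sort_sorted; apply: le_total.
  by rewrite hypercube_char_poly; apply: perm_big; rewrite perm_sym perm_sort.
have cnt (P : pred R) (Q : pred nat) : (forall l : nat, P (K * l%:R) = Q l) ->
    count P (sort <=%R s) = #|[set A : {set 'I_N} | Q #|A|]|.
  move=> PQ; rewrite (permP (permEl (perm_sort _ _))) count_map.
  rewrite -(on_card_preimset (f := f)); last by exists g => A _; [apply: fK | apply: gK].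
  rewrite cardE size_filter -enumT; apply: eq_count => x.
  by rewrite /= !inE PQ.
apply: nth_sorted_count; first by apply: sort_sorted; apply: le_total.
  (* Only the empty set gives an eigenvalue below [K]; an edge exists, so this one is at most [N].
     With the [N] singletons there are at least [N + 1] eigenvalues up to [K]. *)
  rewrite (cnt _ (fun l => l == 0%N)) => [|l]; last first.
    by rewrite /= -[ltRHS]mulr1 ltr_pM2l // (ltr_nat R l 1) ltnS leqn0.
  have [x _] := card_gt0P (ltnW V1); have [y xy] := exists_adj (w0 wG) conn x V1.
  rewrite card_draws bin0 -(hypercube_deg x); apply/card_gt0P.
  by exists y; rewrite inE.
rewrite (cnt _ (fun l => l <= 1)%N) => [|l]; last first.
  by rewrite /= -[leRHS]mulr1 ler_pM2l // (ler_nat R l 1).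
have sub : set0 |: [set A : {set 'I_N} | #|A| == 1%N] \subset [set A : {set 'I_N} | #|A| <= 1]%N.
  apply/subsetP => A; rewrite !inE => /orP[/eqP->|/eqP->//].
  by rewrite cards0.
apply: leq_trans (subset_leq_card sub).
by rewrite cardsU1 inE cards0 card_draws card_ord bin1.
Qed.

End Hypercube.

(** * The equivalences *)

Section Equivalences.
Variables (R : realFieldType) (V : finType) (w : V -> V -> R) (m : V -> R) (K : R).
Hypothesis wG : weighted_graph w m.
Hypothesis conn : connected w.
Local Notation D := (Degmax w m).
Local Notation d := (dist w).

(** On the second sphere the neighbours of [z] nearer to [x] are exactly the common neighbours, so
    the premise of NCP says that all these counts are 2. *)
Lemma dminus_common x z : z \in sphere w 2 x ->
  dminus (unw w) (@one_m R V) x z = (common w x z)%:R.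
Proof.
rewrite inE => /eqP xz; rewrite dminus_unw; congr (_%:R).
apply: eq_card => y; rewrite !inE andbC [d z x](distC (wC wG) conn) xz.
case: (boolP (adj w y z)) => yz; last by rewrite !andbF.
rewrite !andbT [d y x](distC (wC wG) conn) -(dist_eq1 (w0 wG) conn).
by have := dist_triangle conn y x z; move: yz; rewrite -(dist_eq1 (w0 wG) conn) xz; lia.
Qed.

Lemma Deg_const_edge k x : 0 < k -> const_edge_deg w m k -> Deg w m x = k * (deg w x)%:R.
Proof.
move=> k0 cE; rewrite DegE degE mulr_sumr.
by apply: eq_bigr => y _; rewrite (const_edge_rate wG k0 cE).
Qed.

Lemma dminus_const_edge k x z : 0 < k -> const_edge_deg w m k ->
  dminus w m x z = k * dminus (unw w) (@one_m R V) x z.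
Proof.
move=> k0 cE; rewrite (dminusE wG) dminus_unw -sum1_card natr_sum mulr_sumr.
rewrite [RHS]big_mkcond; apply: eq_bigr => y _ /=.
rewrite (const_edge_rate wG k0 cE) inE (adjC (wC wG) z y).
by case: (adj w y z) (d y x < d z x)%N => [] []; rewrite /= ?mulr1 ?mulr0.
Qed.

Lemma SSP_NCP_to_hypercube : HSS (unw w) (@one_m R V) (2%:R * D / K) 1 ->
  (forall x, SSP (unw w) x /\ NCP (unw w) (@one_m R V) x) ->
  exists N : nat, N%:R = 2%:R * D / K /\ is_hypercube w N.
Proof.
move=> [x0 [_ _ DegE' bip' dm]] loc.
have degE' x : (deg w x)%:R = 2%:R * D / K by rewrite -Deg_unw DegE' mulr1.
have degn x : deg w x = deg w x0 by apply/eqP; rewrite -(eqr_nat R) !degE'.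
have bip : bipartite w.
  by case: bip' => c cP; exists c => x y; rewrite -adj_unw; apply: cP.
exists (deg w x0); split => //.
apply: (@shells_hypercube _ _ w m x0 (deg w x0) wG conn bip degn).
- by move=> z; apply/eqP; rewrite -(eqr_nat R) -dminus_unw dm mul1r dist_unw.
- by move=> x; have [] := loc x; rewrite /SSP sphere_unw deg_unw.
- move=> x c2 y1 y2 xy1 xy2 y12; have [_ ncp] := loc x.
  have := ncp _ y1 y2; rewrite !sphere_unw !inE !(dist_eq1 (w0 wG) conn).
  move=> /(_ _ xy1 xy2 y12) H; apply: leq_trans (H _).
    by apply/eq_leq/eq_card => z; rewrite !inE !adj_unw ?dist_unw.
  by move=> z zS; rewrite dminus_common ?c2.
Qed.

Hypothesis V1 : (1 < #|V|)%N.
Hypothesis K0 : 0 < K.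

(** Evaluate (iii) at a neighbour of [x0]: its only nearer neighbour is [x0] itself, so its backward
    degree is [k]. *)
Lemma const_edge_half k : 0 < k -> const_edge_deg w m k ->
  HSS w m (2%:R * D / K) (K / 2%:R) -> k = K / 2%:R.
Proof.
move=> k0 cE [x0 [_ _ _ _ dm]].
have [y xy] := exists_adj (w0 wG) conn x0 V1.
have y1 : d y x0 = 1%N by apply/eqP; rewrite (dist_eq1 (w0 wG) conn) (adjC (wC wG)).
have := dm y; rewrite y1 mulr1 => <-; rewrite (dminusE wG) (bigD1 x0) //= y1.
rewrite (distxx conn) (const_edge_rate wG k0 cE) (adjC (wC wG)) xy !mulr1 big1 ?addr0 //.
by move=> z zx; rewrite ltnS leqn0 (dist_eq0 conn) (negPf zx) mulr0.
Qed.

Lemma HSS_to_SSP_NCP : (exists k, 0 < k /\ const_edge_deg w m k) ->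
  HSS w m (2%:R * D / K) (K / 2%:R) -> CDinf w m K ->
  const_edge_deg w m (K / 2%:R) /\ HSS (unw w) (@one_m R V) (2%:R * D / K) 1
  /\ forall x, SSP (unw w) x /\ NCP (unw w) (@one_m R V) x.
Proof.
move=> [k [k0 cE]] hss CD; have kK := const_edge_half k0 cE hss; subst k.
have [x0 [N0 _ DegE' bip dm]] := hss.
have degE' x : (deg w x)%:R = 2%:R * D / K.
  by apply: (mulfI (lt0r_neq0 k0)); rewrite -(Deg_const_edge x k0 cE) DegE' mulrC.
have degn x : deg w x = deg w x0 by apply/eqP; rewrite -(eqr_nat R) !degE'.
have rE := const_edge_rate wG k0 cE.
split=> //; split.
  exists x0; split => //.
  - by move=> x; rewrite Deg_unw degE' mulr1.
  - by case: bip => c cP; exists c => x y; rewrite adj_unw; apply: cP.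
  - move=> x; apply: (mulfI (lt0r_neq0 k0)).
    by rewrite -(dminus_const_edge x0 x k0 cE) dm dist_unw mul1r.
move=> x; split.
  by rewrite /SSP sphere_unw deg_unw; apply: (curvature_SSP wG conn bip K0 CD rE degn).
move=> dm2 y1 y2; rewrite !sphere_unw !inE !(dist_eq1 (w0 wG) conn) => xy1 xy2 y12.
apply: leq_trans (curvature_NCP wG conn bip K0 CD rE degn _ xy1 xy2 y12).
  apply/eq_leq/eq_card => z; rewrite !inE !adj_unw.
  by rewrite ?dist_unw.
move=> z zS; apply/eqP; rewrite -(eqr_nat R) -dminus_common // dm2 //.
by rewrite sphere_unw.
Qed.

End Equivalences.

Theorem theorem2 (R : rcfType) (V : finType) (w : V -> V -> R) (m : V -> R)
    (K : R) :
  weighted_graph w m -> connected w -> (1 < #|V|)%N -> 0 < K ->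
  [<-> (exists N : nat, N%:R = 2%:R * Degmax w m / K /\ is_hypercube w N)
         /\ const_edge_deg w m (K / 2%:R);
       CDinf w m K /\ lambda_eq w m (degmax w) K;
       (exists k0, 0 < k0 /\ const_edge_deg w m k0) /\ CDinf w m K
         /\ (diam w)%:R = 2%:R * Degmax w m / K;
       (exists k0, 0 < k0 /\ const_edge_deg w m k0)
         /\ HSS w m (2%:R * Degmax w m / K) (K / 2%:R) /\ CDinf w m K;
       const_edge_deg w m (K / 2%:R)
         /\ HSS (unw w) (@one_m R V) (2%:R * Degmax w m / K) 1
         /\ (forall x, SSP (unw w) x /\ NCP (unw w) (@one_m R V) x)].
Proof.
move=> wG conn V1 K0; tfae.
- case=> [[N [_ [f [[g fK gK] fadj]]]] cE]; split.
    exact: (hypercube_CD wG K0 cE fK gK fadj).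
  exact: (hypercube_lambda wG conn V1 K0 cE fK gK fadj).
(* The diameter in (3) is read off the shell structure by [HSS_diam]. *)
- case=> CD lK; split; last first.
    by split=> //; apply: (HSS_diam wG conn K0 CD); apply: lambda_HSS.
  exists (K / 2%:R); rewrite divr_gt0 ?ltr0n //; split=> //.
  exact: (lambda_const_edge_deg wG conn V1 K0 CD).
- case=> kE [CD dE]; split=> //; split=> //.
  exact: (diam_HSS wG conn K0 CD V1).
- case=> kE [hss CD]; exact: (HSS_to_SSP_NCP wG conn V1 K0 kE hss CD).
- case=> cE [hss loc]; split=> //.
  exact: (SSP_NCP_to_hypercube wG conn hss loc).
Qed.
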